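(* Let $n\ge 2$ and let $U$ be any infinite set of unit vectors in $\mathbb{R}^n$. Then for every $1<p<\infty$, the operator $\mathscr{H}_U$ cannot be extended to a bounded operator on $L^p(\mathbb{R}^n)$; that is, there is no finite constant $A$ such that $\|\mathscr{H}_U f\|_p\le A\|f\|_p$ for all Schwartz functions $f$ on $\mathbb{R}^n$.
   Context: For a unit vector $v\in\mathbb{R}^n$, the directional Hilbert transform is defined on Schwartz functions $f$ on $\mathbb{R}^n$ by $$\mathscr{H}_v f(x)=\frac1\pi\lim_{\epsilon\to0^+}\int_{|t|>\epsilon} f(x-tv)\,\frac{dt}{t},\qquad x\in\mathbb{R}^n.$$ For a set $U$ of unit vectors, the maximal directional Hilbert transform is $\mathscr{H}_U f(x)=\sup_{v\in U}|\mathscr{H}_v f(x)|$ for Schwartz $f$. *)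

(* Defs.v *)
From HB Require Import structures.
From mathcomp Require Import all_boot all_order all_algebra.
From mathcomp Require Import complex.
From mathcomp Require Import all_classical all_reals all_analysis.

Set Implicit Arguments.
Unset Strict Implicit.
Unset Printing Implicit Defensive.
Import Order.TTheory GRing.Theory Num.Theory.
Import numFieldNormedType.Exports.
Local Open Scope classical_set_scope.
Local Open Scope ring_scope.

(** The library has no Lebesgue measure on R^n: it is built on [n.-tuple R]
    (which carries the product sigma-algebra) by iterating the product measure
    with [lebesgue_measure].  [lebesgue_tuple_box] checks the volume of boxes. *)
Section lebesgue_tuple.
Context {R : realType}.
Local Notation TR := (measurableTypeR R).

Definition tcons n (xt : TR * n.-tuple TR) : n.+1.-tuple TR :=
  [tuple of xt.1 :: xt.2].

Definition tuncons n (t : n.+1.-tuple TR) : TR * n.-tuple TR :=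
  (thead t, [tuple of behead t]).

Lemma tconsK n : cancel (@tcons n) (@tuncons n).
Proof. by move=> [x t]; congr pair; exact/val_inj. Qed.

Lemma measurable_tcons n : measurable_fun [set: TR * n.-tuple TR] (@tcons n).
Proof. exact: (measurable_cons measurable_fst measurable_snd). Qed.

Lemma measurable_tuncons n :
  measurable_fun [set: n.+1.-tuple TR] (@tuncons n).
Proof.
by apply/measurable_fun_pair; [exact: measurable_tnth|exact: measurable_behead].
Qed.

Section lebesgue_cons.
Local Open Scope ereal_scope.
Variables (n : nat) (m : {sigma_finite_measure set (n.-tuple TR) -> \bar R}).

Definition lebesgue_cons : set (n.+1.-tuple TR) -> \bar R :=
  pushforward (lebesgue_measure \x m) (@tcons n).

Let lebesgue_cons0 : lebesgue_cons set0 = 0.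
Proof. by rewrite /lebesgue_cons /pushforward preimage_set0 measure0. Qed.

Let lebesgue_cons_ge0 A : 0 <= lebesgue_cons A.
Proof. by rewrite /lebesgue_cons /pushforward measure_ge0. Qed.

Let lebesgue_cons_sigma_additive : semi_sigma_additive lebesgue_cons.
Proof.
move=> F mF tF mUF; rewrite /lebesgue_cons /pushforward preimage_bigcup.
apply: measure_semi_sigma_additive.
- by move=> k; rewrite -[X in measurable X]setTI; exact: measurable_tcons.
- apply/trivIsetP => /= i j _ _ ij; rewrite -preimage_setI.
  by move/trivIsetP : tF => /(_ _ _ _ _ ij) ->//; rewrite preimage_set0.
- rewrite -preimage_bigcup -[X in measurable X]setTI.
  exact: measurable_tcons.
Qed.

HB.instance Definition _ := isMeasure.Build _ _ _ lebesgue_cons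
  lebesgue_cons0 lebesgue_cons_ge0 lebesgue_cons_sigma_additive.

Lemma lebesgue_consX (A : set TR) (B : set (n.-tuple TR)) :
  measurable A -> measurable B ->
  lebesgue_cons (@tuncons n @^-1` (A `*` B)) = lebesgue_measure A * m B.
Proof.
move=> mA mB; rewrite /lebesgue_cons /pushforward -comp_preimage.
rewrite (_ : _ \o _ = id); last by apply/funext => x /=; rewrite tconsK.
by rewrite preimage_id product_measure1E.
Qed.

Let lebesgue_cons_sigma_finite : sigma_finite setT lebesgue_cons.
Proof.
have /sigma_finiteP[F [TF ndF Foo]] :=
  sigma_finiteT (@lebesgue_measure R : {sigma_finite_measure set TR -> \bar R}).
have /sigma_finiteP[G [TG ndG Goo]] := sigma_finiteT m.
exists (fun k => @tuncons n @^-1` (F k `*` G k)).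
  rewrite -preimage_bigcup (_ : \bigcup_i _ = setT) ?preimage_setT//.
  rewrite -setXTT TF TG predeqE => -[x y]; split.
    by move=> [k _ []/= ? ?]; split; exists k.
  move=> [/= [k _ Fkx] [l _ Gly]]; exists (maxn k l) => //; split.
  - by move: x Fkx; exact/subsetPset/ndF/leq_maxl.
  - by move: y Gly; exact/subsetPset/ndG/leq_maxr.
move=> k; have [? ?] := Foo k; have [? ?] := Goo k; split.
  rewrite -[X in measurable X]setTI; apply: measurable_tuncons => //.
  exact: measurableX.
by rewrite lebesgue_consX// lte_mul_pinfty// ge0_fin_numE.
Qed.

HB.instance Definition _ :=
  Measure_isSigmaFinite.Build _ _ _ lebesgue_cons lebesgue_cons_sigma_finite.

End lebesgue_cons.

Fixpoint lebesgue_tuple n : {sigma_finite_measure set (n.-tuple TR) -> \bar R} :=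
  if n is n'.+1 then lebesgue_cons (lebesgue_tuple n') else \d_[tuple].

Lemma lebesgue_tuple_box n (A : 'I_n -> set TR) :
  (forall i, measurable (A i)) ->
  lebesgue_tuple n [set t | forall i, A i (tnth t i)] =
  (\prod_(i < n) lebesgue_measure (A i))%E.
Proof.
elim: n A => [|n IHn] A mA; first by rewrite big_ord0 /= diracE mem_set// => -[].
rewrite big_ord_recl -(IHn (fun i => A (lift ord0 i)))// -lebesgue_consX//.
  congr lebesgue_cons; apply/seteqP; split => t /=; case/tupleP: t => x t.
  - move=> At; split; first exact: (At ord0).
    move=> i; have := At (lift ord0 i); rewrite tnthS.
    by congr A; congr tnth; exact/val_inj.
  - move=> [Ax At] i; case: (unliftP ord0 i) => [j ->|-> //].
    by have := At j; rewrite tnthS; congr A; congr tnth; exact/val_inj.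
rewrite (_ : mkset _ = \bigcap_(i in [set: 'I_n])
  ((fun t : n.-tuple TR => tnth t i) @^-1` A (lift ord0 i))); last first.
  by apply/seteqP; split => [t At i _|t At i]; exact: At.
apply: fin_bigcap_measurable => // i _.
by rewrite -[X in measurable X]setTI; exact: measurable_tnth.
Qed.

End lebesgue_tuple.

Section real_valued.
Context {R : realType} {n : nat}.
Implicit Types (f : 'rV[R]_n -> R) (v x : 'rV[R]_n).

Definition partial (i : 'I_n) f : 'rV[R]_n -> R :=
  fun x => 'D_(delta_mx 0 i) f x.

(** [iter_partial [:: i1; ...; ik] f] is d_{i1} ... d_{ik} f. *)
Definition iter_partial (s : seq 'I_n) f : 'rV[R]_n -> R := foldr partial f s.

Definition smooth f : Prop := forall s : seq 'I_n,
  continuous (iter_partial s f) /\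
  forall (i : 'I_n) x, derivable (iter_partial s f) x (delta_mx 0 i).

Definition schwartz_real f : Prop :=
  smooth f /\
  forall (a : 'I_n -> nat) (s : seq 'I_n), exists C : R, forall x,
    `|(\prod_(i < n) x ord0 i ^+ a i) * iter_partial s f x| <= C.

Definition hilbert_real v f x : R :=
  pi^-1 * lim ((\int[lebesgue_measure]_(t in [set t | eps < `|t|])
                  (f (x - t *: v) / t)) @[eps --> 0^'+]).

End real_valued.

(** Schwartz functions are complex valued; derivatives, integrals and limits of
    complex-valued functions are taken on real and imaginary parts. *)
Section complex_valued.
Context {R : realType} {n : nat}.
Implicit Types (f : 'rV[R]_n -> R[i]) (v x : 'rV[R]_n) (U : set 'rV[R]_n).

Definition schwartz f : Prop :=
  schwartz_real (fun x => complex.Re (f x)) /\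
  schwartz_real (fun x => complex.Im (f x)).

Definition hilbert v f x : R[i] :=
  Complex (hilbert_real v (fun y => complex.Re (f y)) x)
          (hilbert_real v (fun y => complex.Im (f y)) x).

Definition max_hilbert U f x : \bar R :=
  ereal_sup [set (Normc.normc (hilbert v f x))%:E | v in U].

(** Euclidean; the library's norm on ['rV[R]_n] is the sup norm. *)
Definition unit_vector v : Prop := \sum_(i < n) v ord0 i ^+ 2 = 1.

Definition row_of_tuple (t : n.-tuple (measurableTypeR R)) : 'rV[R]_n :=
  \row_i tnth t i.

Definition Lp_norm (p : R) (g : 'rV[R]_n -> \bar R) : \bar R :=
  'N[lebesgue_tuple n]_(p%:E)[g \o row_of_tuple].

End complex_valued.

(* Main.v *)
From HB Require Import structures.
Require Import Defs.
From mathcomp Require Import all_boot all_order all_algebra.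
From mathcomp Require Import complex ring lra.
From mathcomp Require Import all_classical all_reals all_analysis measurable_realfun.

Set Implicit Arguments.
Unset Strict Implicit.
Unset Printing Implicit Defensive.
Import Order.TTheory GRing.Theory Num.Theory.
Import numFieldNormedType.Exports.
Local Open Scope classical_set_scope.
Local Open Scope ring_scope.

(** Fix coordinates [i], [l] such that the ratios [s = v_i / v_l], for [v] in [U],
    take infinitely many values.  On a Gaussian times [T (M x_i, M x_l)], where [T]
    is a trigonometric polynomial in two variables, the Hilbert transform along [v]
    multiplies the term of frequency [(p, q)] by [- i sgn (p s + q)], up to a global
    sign and an error which vanishes as [M] tends to infinity.  A bound on [L^p]
    therefore passes to the maximal conjugation operator on trigonometric
    polynomials, for the mean over the plane.

    This operator is unbounded.  If [t] separates the ratios in [L] from the larger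
    ones in [Rr], put [theta = y - t z] and
      [f = cos theta + phi * fR (M .) + (1 - phi) * fL (M .)]
    with a large [M] and a trigonometric polynomial [phi] close to the indicator of
    [sin theta > 0].  The conjugate of [cos theta] is [sin theta] for the ratios in
    [Rr] and [- sin theta] for those in [L], so selecting the subtree according to
    the sign of [sin theta] gains a fixed amount at each level.  After [m] levels
    [f] is bounded by [m], its mean square is only of order [m], and the selected
    conjugate has mean at least [m / 4]; dividing by [m] contradicts the bound. *)

(** * Calculus and Gaussian integrals on the line *)

Section one_dim.
Context {R : realType}.
Implicit Types (f g F : R -> R) (q b S a t u : R).
Local Notation mu := (@lebesgue_measure R).

(** The supremum over directions is linearised by weights [g s], themselves nonnegative
    trigonometric polynomials with sum 1. Every quantity then stays a trigonometric polynomial, its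
    mean is a constant coefficient, and for large [M] the independence of a factor and a dilated one
    is an exact identity between means. The indicator of [sin theta > 0] is not a polynomial; its
    substitute must lose so little mass that the loss, weighted by the inherited [m / 4], stays
    below the gain. A level gains [1 / 2] and loses at most [1 / 4].

    All exponents are treated at once by two pointwise inequalities. For [0 <= y <= 1],
    [y^p <= b^p + y^2 / b^2], so a test polynomial bounded by 1 with small mean square has a small
    [p]-th moment. For [u >= 0], [u^p >= c^(p-1) (u - c)], so a conjugate of mean at least [1 / 4]
    has its [p]-th moment bounded below. Both right-hand sides are again trigonometric polynomials,
    whose means can be taken. Since [U] may be uncountable, the maximal function is compared under
    the integral by a lemma that asks for no measurability. *)

Lemma is_derive_continuous f (f' : R -> R) :
  (forall x : R, is_derive x 1 f (f' x)) -> continuous f.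
Proof.
move=> h x; apply: differentiable_continuous.
by apply/derivable1_diffP; have [] := h x.
Qed.

Lemma continuous_measurable_real f : continuous f -> measurable_fun setT f.
Proof. by move=> cf; exact: measurable_realfun.continuous_measurable_fun. Qed.

Lemma derive0_cst f (x y : R) : (forall u : R, is_derive u 1 f 0) -> f x = f y.
Proof.
wlog xy : x y / x < y.
  move=> H h; have [xy|yx|->//] := ltgtP x y; first exact: H.
  by apply/esym/H.
move=> h; have [|c _] := @MVT _ f (fun=> 0) x y xy (fun u _ => h u).
  apply: continuous_subspaceT => //; exact: (is_derive_continuous h).
by rewrite mul0r => /eqP; rewrite subr_eq0 => /eqP.
Qed.

(** The fundamental theorem of calculus on [[-n, n]], followed by dominated convergence with [|f|]
    itself as the bound. *)
Lemma Rintegral_derive0 F f : (forall t : R, is_derive t 1 F (f t)) ->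
  continuous f -> mu.-integrable setT (EFin \o f) ->
  F n%:R @[n --> \oo] --> (0 : R) -> F (- n%:R) @[n --> \oo] --> (0 : R) ->
  \int[mu]_t f t = 0.
Proof.
move=> dF cf intf Fp Fm.
have cF := is_derive_continuous dF.
pose I (n : nat) : set R := `[- (n%:R : R), n%:R]%classic.
pose fn n := (EFin \o f) \_ (I n).
have mI n : measurable (I n) by exact: measurable_itv.
(* The index is shifted by one because the fundamental theorem is applied on a nondegenerate
   interval. *)
have Iint n : (\int[mu]_t fn n.+1 t)%E = (F n.+1%:R - F (- n.+1%:R))%:E.
  rewrite -integral_mkcond.
  have ltn : - n.+1%:R < n.+1%:R :> R by rewrite gtrN.
  rewrite (@continuous_FTC2 _ f F)//.
  - exact: continuous_subspaceT.
  - split.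
    + by move=> x _; have [] := dF x.
    + by apply: cvg_at_right_filter; exact: cF.
    + by apply: cvg_at_left_filter; exact: cF.
  - by move=> x _; rewrite derive1E; apply: derive_val; exact: dF.
have [| | | | |_ _ cv] := @dominated_convergence _ _ _ mu setT measurableT
   (fun n => fn n.+1) (EFin \o f) (abse \o (EFin \o f)).
  - move=> n; apply/(measurable_restrictT _ (mI _)).
    exact: measurable_funS (measurable_int _ intf).
  - exact: measurable_int intf.
  - apply/aeW => t _; apply: cvg_near_cst.
    near=> n; rewrite /fn patchE mem_set// /I/= in_itv/= -ler_norml.
    apply: (@le_trans _ _ n%:R); last by rewrite ler_nat.
    near: n; exact: nbhs_infty_ger.
  - exact: integrable_abse.
  - apply/aeW => t n _ /=; rewrite /fn patchE; case: ifPn => //= _.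
    by rewrite lee_fin normr0 normr_ge0.
rewrite /Rintegral.
suff -> : (\int[mu]_t (f t)%:E)%E = 0%E by [].
have : (F n.+1%:R - F (- n.+1%:R))%:E @[n --> \oo] --> (0 - 0 : R)%:E.
  apply: cvg_EFin; first exact: nearW.
  apply: cvgB.
    by move: Fp; rewrite -(cvg_shiftS (fun n : nat => F n%:R)).
  by move: Fm; rewrite -(cvg_shiftS (fun n : nat => F (- n%:R))).
rewrite subrr; move: cv; under eq_fun do rewrite Iint.
by move=> h1 h2; exact: (cvg_unique _ h1 h2).
Unshelve. all: by end_near. Qed.

(** Only its positivity is ever extracted: it enters the constant of the principal value, and its
    power cancels from the final inequality between means. *)
Definition gaussZ q : R := \int[mu]_t expR (- q * t ^+ 2 / 2).

Lemma gauss_normal_pdf q t : 0 < q ->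
  expR (- q * t ^+ 2 / 2) = (normal_peak (Num.sqrt q)^-1)^-1 *
     normal_pdf 0 (Num.sqrt q)^-1 t.
Proof.
move=> q0; have s0 : (Num.sqrt q)^-1 != 0 by rewrite invr_neq0// gt_eqF// sqrtr_gt0.
have -> : normal_pdf 0 (Num.sqrt q)^-1 t =
    normal_peak (Num.sqrt q)^-1 * normal_fun 0 (Num.sqrt q)^-1 t by rewrite normal_pdfE.
rewrite mulrA mulVf ?mul1r; last first.
  by rewrite gt_eqF// normal_peak_gt0.
rewrite /normal_fun; congr expR; rewrite subr0 exprVn sqr_sqrtr ?ltW//.
rewrite -mulr_natr; field; exact: lt0r_neq0.
Qed.

Lemma integrable_gauss q : 0 < q ->
  mu.-integrable setT (EFin \o (fun t => expR (- q * t ^+ 2 / 2))).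
Proof.
move=> q0; rewrite /comp; under eq_fun do rewrite gauss_normal_pdf// EFinM.
by apply: integrableZl => //; exact: integrable_normal_pdf.
Qed.

Lemma gaussZ_gt0 q : 0 < q -> 0 < gaussZ q.
Proof.
move=> q0; rewrite /gaussZ.
under eq_Rintegral do rewrite gauss_normal_pdf//.
rewrite RintegralZl//; last exact: integrable_normal_pdf.
rewrite /Rintegral integral_normal_pdf mulr1 invr_gt0 normal_peak_gt0//.
by rewrite invr_neq0// gt_eqF// sqrtr_gt0.
Qed.

Lemma integrable_le_gauss f q C : 0 < q -> measurable_fun setT f ->
  (forall t, `|f t| <= C * expR (- q * t ^+ 2 / 2)) ->
  mu.-integrable setT (EFin \o f).
Proof.
move=> q0 mf fC.
apply: (@le_integrable _ _ _ mu setT _ _ (fun t => C%:E * (expR (- q * t ^+ 2 / 2))%:E)%E) => //.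
- exact/measurable_EFinP.
- move=> t _ /=; rewrite lee_fin; apply: le_trans (fC t) _; exact: ler_norm.
- by apply: integrableZl => //; exact: integrable_gauss.
Qed.

(** With [1 + |t| <= exp |t|] the exponent is at most [- q t^2 / 2 + (B + 1) |t|]; half of the
    quadratic term absorbs the linear one by completing the square. The bound is uniform in
    [|b| <= B], hence fit for differentiation under the integral. *)
Lemma gauss_dom q b t B : 0 < q -> `|b| <= B ->
  expR (- q * t ^+ 2 / 2 + b * t) * (1 + `|t|) <=
  expR ((B + 1) ^+ 2 / q) * expR (- (q / 2) * t ^+ 2 / 2).
Proof.
move=> q0 bB.
have h : 1 + `|t| <= expR `|t| by exact: expR_ge1Dx.
apply: le_trans (ler_wpM2l (expR_ge0 _) h) _.
rewrite -!expRD ler_expR.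
have h1 : b * t <= B * `|t|.
  apply: le_trans (ler_norm _) _; rewrite normrM; exact: ler_wpM2r.
have -> : t ^+ 2 = `|t| ^+ 2 by rewrite real_normK// num_real.
set y := `|t| in h1 *.
have h2 : 0 <= (q * y / 2 - (B + 1)) ^+ 2 / q.
  by rewrite divr_ge0 ?sqr_ge0// ltW.
have h3 : (q * y / 2 - (B + 1)) ^+ 2 / q = q * y ^+ 2 / 4 - (B + 1) * y + (B + 1) ^+ 2 / q.
  by field; exact: lt0r_neq0.
lra.
Qed.

End one_dim.

(** * The Gaussian integral with a complex linear exponent *)

Section gauss_transform.
Context {R : realType}.
Implicit Types (q b S a t u : R).
Local Notation mu := (@lebesgue_measure R).

Lemma is_derive_Rintegral (f f' : R -> R -> R) (D : set R) (G : R -> R) (u : R) :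
  measurable D ->
  (forall x, mu.-integrable D (EFin \o f x)) ->
  (forall x t, D t -> is_derive x (1 : R) (f ^~ t) (f' x t)) ->
  (forall t, 0 <= G t) -> mu.-integrable D (EFin \o G) ->
  (forall x t, `|x - u| < 1 -> D t -> `|f' x t| <= G t) ->
  is_derive u (1 : R) (fun x => \int[mu]_(t in D) f x t) (\int[mu]_(t in D) f' u t).
Proof.
move=> mD intf df G0 intG fG.
have Iu : `](u - 1), (u + 1)[%classic u by rewrite /= in_itv/=; apply/andP; split; lra.
have h x t : `](u - 1), (u + 1)[%classic x -> D t -> `|partial1of2 f x t| <= G t.
  rewrite /= in_itv/= => /andP[h1 h2] Dt.
  rewrite partial1of2E (derive_val (is_derive := df x t Dt)).
  by apply: fG => //; rewrite ltr_norml; apply/andP; split; lra.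
have dd : forall x t, `](u - 1), (u + 1)[%classic x -> D t -> derivable (f ^~ t) x 1.
  by move=> x t _ Dt; have [] := df x t Dt.
split.
  have H := @derivable_under_integral R _ _ mu f D mD u _ _ Iu (fun x _ => intf x) dd G G0 intG h.
  exact H.
rewrite -derive1E.
have H := @differentiation_under_integral R _ _ mu f D mD u _ _ Iu (fun x _ => intf x) dd G G0 intG h.
rewrite H.
apply: eq_Rintegral => t; rewrite inE => Dt.
by rewrite partial1of2E (derive_val (is_derive := df u t Dt)).
Qed.

(** Exponents and phases are all quadratic, in the integration variable and in the deformation
    parameter alike, so one derivative lemma serves both. *)
Definition qd (c0 c1 c2 u : R) := c0 + c1 * u + c2 * u ^+ 2.

Lemma is_derive_qd (c0 c1 c2 x : R) :
  is_derive x (1:R) (qd c0 c1 c2) (c1 + c2 * (x *+ 2)).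
Proof.
by rewrite /qd; apply: is_derive_eq; rewrite /GRing.scale/=; ring.
Qed.

Lemma is_derive_expcos (g h : R -> R) (x g' h' : R) :
  is_derive x (1:R) g g' -> is_derive x (1:R) h h' ->
  is_derive x (1:R) (fun u => expR (g u) * cos (h u))
    (expR (g x) * (cos (h x) * g' - sin (h x) * h')).
Proof.
by move=> ? ?; apply: is_derive_eq; rewrite /GRing.scale/=; ring.
Qed.

Lemma is_derive_expsin (g h : R -> R) (x g' h' : R) :
  is_derive x (1:R) g g' -> is_derive x (1:R) h h' ->
  is_derive x (1:R) (fun u => expR (g u) * sin (h u))
    (expR (g x) * (sin (h x) * g' + cos (h x) * h')).
Proof.
by move=> ? ?; apply: is_derive_eq; rewrite /GRing.scale/=; ring.
Qed.

Lemma continuous_qd (c0 c1 c2 : R) : continuous (qd c0 c1 c2).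
Proof. exact: (is_derive_continuous (fun x => is_derive_qd c0 c1 c2 x)). Qed.

Lemma continuous_expcos (c0 c1 c2 d0 d1 d2 : R) :
  continuous (fun t => expR (qd c0 c1 c2 t) * cos (qd d0 d1 d2 t)).
Proof.
exact: (is_derive_continuous (fun x =>
  is_derive_expcos (is_derive_qd c0 c1 c2 x) (is_derive_qd d0 d1 d2 x))).
Qed.


Lemma norm_cos_le1 (x : R) : `|cos x| <= 1.
Proof. by rewrite ler_norml cos_geN1 cos_le1. Qed.

Lemma norm_sin_le1 (x : R) : `|sin x| <= 1.
Proof. by rewrite ler_norml sin_geN1 sin_le1. Qed.

(** The factor [1 + |t|] in [gauss_dom] yields a bound by a constant over [1 + n]; [s] is 1 or -1,
    for the two ends of the line. *)
Lemma cvg_gauss_nat q b c (s : R) : 0 < q -> `|s| = 1 ->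
  expR (qd c b (- q / 2) (s * n%:R)) @[n --> \oo] --> (0 : R).
Proof.
move=> q0 s1.
pose C := expR (c + (`|b| + 1) ^+ 2 / q).
apply: (@squeeze_cvgr _ _ _ _ (fun=> 0) (fun n : nat => C * (n.+1%:R)^-1)).
- near=> n; rewrite expR_ge0/= ler_pdivlMr ?ltr0Sn// /C /qd.
  have := @gauss_dom R q b (s * n%:R) `|b| q0 (lexx _).
  rewrite normrM s1 mul1r (ger0_norm (ler0n _ _)) -addn1 natrD => h.
  have {}h := ler_wpM2l (expR_ge0 c) h.
  apply: le_trans (le_trans h _).
    rewrite [leRHS]mulrA -[X in _ <= X * _]expRD (_ : n.+1%:R = 1 + n%:R); last by rewrite -natr1 addrC.
    by apply: ler_wpM2r; rewrite ?addr_ge0 ?ler0n// ler_expR; lra.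
  rewrite [leRHS]expRD; apply: ler_wpM2l; rewrite ?expR_ge0//.
  rewrite ger_pMr ?expR_gt0// expR_le1 !mulNr oppr_le0.
  by rewrite divr_ge0// mulr_ge0 ?sqr_ge0// divr_ge0// ltW.
- exact: cvg_cst.
- rewrite -[X in _ --> X](mulr0 C); apply: cvgM; first exact: cvg_cst.
  exact: cvg_harmonic.
Unshelve. all: by end_near. Qed.

Lemma norm_gauss_lin q b (c0 t B C0 : R) : 0 < q -> `|b| <= B -> c0 <= C0 ->
  expR (qd c0 b (- q / 2) t) * (1 + `|t|) <=
  expR (C0 + (B + 1) ^+ 2 / q) * expR (- (q / 2) * t ^+ 2 / 2).
Proof.
move=> q0 bB cC; have h := gauss_dom t q0 bB.
have -> : qd c0 b (- q / 2) t = c0 + (- q * t ^+ 2 / 2 + b * t) by rewrite /qd; ring.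
rewrite expRD -[leLHS]mulrA [expR (C0 + _)]expRD -[leRHS]mulrA.
by apply: ler_pM; rewrite ?mulr_ge0 ?addr_ge0 ?expR_ge0 ?ler_expR.
Qed.

Lemma integrable_expcos q b c (d0 d1 d2 : R) : 0 < q ->
  mu.-integrable setT (EFin \o (fun t => expR (qd c b (- q / 2) t) * cos (qd d0 d1 d2 t))).
Proof.
move=> q0; apply: (@integrable_le_gauss _ _ (q / 2) (expR (c + (`|b| + 1) ^+ 2 / q))).
- by rewrite divr_gt0.
- by apply: continuous_measurable_real; exact: continuous_expcos.
- move=> t; rewrite normrM ger0_norm ?expR_ge0//.
  apply: le_trans (norm_gauss_lin t q0 (lexx `|b|) (lexx c)).
  by apply: ler_wpM2l; rewrite ?expR_ge0// (le_trans (norm_cos_le1 _))// lerDl.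
Qed.

Section parameter.
Variables (q b S a : R).
Hypothesis q0 : 0 < q.
Let c := - ((b ^+ 2 - S ^+ 2) / (2 * q)).
Let d := - (b * S / q).
Let E u t := expR (qd (c * u ^+ 2) (u * b) (- q / 2) t).
Let Cs u t := cos (qd (a + d * u ^+ 2) (u * S) 0 t).
Let Sn u t := sin (qd (a + d * u ^+ 2) (u * S) 0 t).
Let f u t := E u t * Cs u t.
Let f' u t :=
  E u t * (Cs u t * (b * t + c * (u *+ 2)) - Sn u t * (S * t + d * (u *+ 2))).

Let df u t : is_derive u (1 : R) (f ^~ t) (f' u t).
Proof.
have e1 x : qd (c * x ^+ 2) (x * b) (- q / 2) t = qd (- q / 2 * t ^+ 2) (b * t) c x.
  by rewrite /qd; ring.
have e2 x : qd (a + d * x ^+ 2) (x * S) 0 t = qd a (S * t) d x.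
  by rewrite /qd; ring.
rewrite /f /f' /E /Cs /Sn; under eq_fun do rewrite e1 e2.
rewrite e1 e2; exact: is_derive_expcos (is_derive_qd _ _ _ _) (is_derive_qd _ _ _ _).
Qed.

Let K W := `|b| + `|S| + (`|c| + `|d|) * (W *+ 2).
Let G W t := K W * expR (`|c| * W ^+ 2 + (W * `|b| + 1) ^+ 2 / q)
  * expR (- (q / 2) * t ^+ 2 / 2).

Let f'_dom W u t : `|u| <= W -> `|f' u t| <= G W t.
Proof.
move=> uW; have W0 : 0 <= W by exact: le_trans uW.
rewrite /f' normrM ger0_norm ?expR_ge0//.
have h : `|Cs u t * (b * t + c * (u *+ 2)) - Sn u t * (S * t + d * (u *+ 2))| <=
    K W * (1 + `|t|).
  apply: le_trans (ler_normB _ _) _; rewrite !normrM.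
  have h1 := norm_cos_le1 (qd (a + d * u ^+ 2) (u * S) 0 t).
  have h2 := norm_sin_le1 (qd (a + d * u ^+ 2) (u * S) 0 t).
  have aux (x y : R) : `|x * t + y * (u *+ 2)| <= (`|x| + `|y| * (W *+ 2)) * (1 + `|t|).
    apply: le_trans (ler_normD _ _) _; rewrite !normrM normrMn mulrDl.
    apply: lerD; first by apply: ler_wpM2l => //; rewrite lerDr.
    rewrite -[leLHS]mulr1; apply: ler_pM; rewrite ?mulr_ge0 ?mulrn_wge0 ?lerDl//.
    by apply: ler_wpM2l => //; rewrite lerMn2r.
  have e : K W * (1 + `|t|) = (`|b| + `|c| * (W *+ 2)) * (1 + `|t|) +
      (`|S| + `|d| * (W *+ 2)) * (1 + `|t|) by rewrite /K; ring.
  rewrite e; apply: lerD; rewrite -[leRHS]mul1r; apply: ler_pM; rewrite ?normr_ge0//; exact: aux.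
apply: le_trans (ler_wpM2l (expR_ge0 _) h) _.
rewrite mulrCA /G -mulrA; apply: ler_wpM2l.
  by rewrite /K !addr_ge0 ?mulr_ge0 ?addr_ge0 ?mulrn_wge0.
apply: norm_gauss_lin => //.
  by rewrite normrM; apply: ler_wpM2r.
apply: le_trans (ler_norm _) _; rewrite normrM; apply: ler_wpM2l => //.
by rewrite normrX lerXn2r ?nnegrE.
Qed.

Let G_ge0 W t : 0 <= W -> 0 <= G W t.
Proof.
move=> W0; rewrite /G mulr_ge0 ?expR_ge0// mulr_ge0 ?expR_ge0//.
by rewrite /K !addr_ge0 ?mulr_ge0 ?addr_ge0 ?mulrn_wge0.
Qed.

Let q2 : 0 < q / 2. Proof. by rewrite divr_gt0. Qed.

Let intG W : mu.-integrable setT (EFin \o G W).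
Proof.
rewrite /G /comp; under eq_fun do rewrite EFinM.
by apply: integrableZl => //; exact: integrable_gauss.
Qed.

Let cf' u : continuous (f' u).
Proof.
move=> t; apply: cvgM; first exact: continuous_comp (@continuous_qd _ _ _ t) (@continuous_expR _ _).
have lin (x y : R) : {for t, continuous (fun t => x * t + y)}.
  by apply: cvgD; [apply: cvgM; [exact: cvg_cst|exact: cvg_id]|exact: cvg_cst].
apply: cvgB; apply: cvgM; try exact: lin.
  exact: continuous_comp (@continuous_qd _ _ _ t) (@continuous_cos _ _).
exact: continuous_comp (@continuous_qd _ _ _ t) (@continuous_sin _ _).
Qed.

Let intf' u : mu.-integrable setT (EFin \o f' u).
Proof.
apply: (integrable_le_gauss q2); last by move=> t; exact: f'_dom (lexx _).
by apply: continuous_measurable_real; exact: cf'.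
Qed.

(* The integrand is [Re (exp (- q (t - u z)^2 / 2 + i a))] with
   [z = (b + i S) / q], so its derivative in [u] is an exact derivative in [t]. *)
Let int_f' u : \int[mu]_t f' u t = 0.
Proof.
pose F t := - (b / q) * (E u t * Cs u t) + (S / q) * (E u t * Sn u t).
have qn : q != 0 by exact: lt0r_neq0.
have dF t : is_derive t (1 : R) F (f' u t).
  have h1 := is_derive_expcos (is_derive_qd (c * u ^+ 2) (u * b) (- q / 2) t)
     (is_derive_qd (a + d * u ^+ 2) (u * S) 0 t).
  have h2 := is_derive_expsin (is_derive_qd (c * u ^+ 2) (u * b) (- q / 2) t)
     (is_derive_qd (a + d * u ^+ 2) (u * S) 0 t).
  rewrite /F /E /Cs /Sn; apply: is_derive_eq; rewrite /GRing.scale /= /f' /E /Cs /Sn.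
  rewrite /c /d; field; exact: qn.
have Fb t : `|F t| <= (`|b / q| + `|S / q|) * E u t.
  rewrite /F; apply: le_trans (ler_normD _ _) _; rewrite mulrDl.
  have e1 : `|E u t * Cs u t| <= E u t.
    by rewrite normrM ger0_norm ?expR_ge0// ler_piMr ?expR_ge0// norm_cos_le1.
  have e2 : `|E u t * Sn u t| <= E u t.
    by rewrite normrM ger0_norm ?expR_ge0// ler_piMr ?expR_ge0// norm_sin_le1.
  by apply: lerD; rewrite normrM ?normrN; apply: ler_wpM2l.
have Fc (s : R) : `|s| = 1 -> F (s * n%:R) @[n --> \oo] --> (0 : R).
  move=> s1; apply: norm_cvg0.
  apply: (@squeeze_cvgr _ _ _ _ (fun=> 0)
     (fun n : nat => (`|b / q| + `|S / q|) * E u (s * n%:R))).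
  - by near=> n; rewrite normr_ge0 Fb.
  - exact: cvg_cst.
  - rewrite -[X in _ --> X](mulr0 (`|b / q| + `|S / q|)); apply: cvgM; first exact: cvg_cst.
    exact: cvg_gauss_nat.
apply: (Rintegral_derive0 dF (@cf' u) (intf' u)).
  by have := Fc 1 (normr1 _); under eq_fun do rewrite mul1r.
by have := Fc (-1) (normrN1 _); under eq_fun do rewrite mulN1r.
Unshelve. all: by end_near. Qed.

Let int_f u : \int[mu]_t f u t = \int[mu]_t f 0 t.
Proof.
apply: (@derive0_cst _ (fun u => \int[mu]_t f u t)) => x.
have W0 : 0 <= `|x| + 1 by rewrite addr_ge0.
have := @is_derive_Rintegral f f' setT (G (`|x| + 1)) x measurableT _ _ (fun t => G_ge0 t W0) (intG _) _.
rewrite int_f'; apply.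
- by move=> y; exact: integrable_expcos.
- by move=> y t _; exact: df.
- move=> y t yx _; apply: f'_dom.
  rewrite -lerBlDl; apply: le_trans (ltW yx); exact: lerB_dist.
Qed.

(** Constancy in [u] takes the place of a contour shift: [u = 0] gives the pure Gaussian times
    [cos a], and [u = 1] gives the integral of the statement up to the factor [exp c]. *)
Lemma gauss_transform_aux :
  \int[mu]_t (expR (qd 0 b (- q / 2) t) * cos (qd (a + d) S 0 t)) =
  gaussZ q * expR ((b ^+ 2 - S ^+ 2) / (2 * q)) * cos a.
Proof.
have : expR (- c) * (\int[mu]_t f 1 t) = expR (- c) * (\int[mu]_t f 0 t) by rewrite int_f.
rewrite -[X in X = _]RintegralZl//; last exact: integrable_expcos.
rewrite (_ : \int[mu]_t f 0 t = gaussZ q * cos a); last first.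
  rewrite /gaussZ -RintegralZr//; last exact: integrable_gauss.
  apply: eq_Rintegral => t _; rewrite /f /E /Cs /qd.
  by congr (expR _ * cos _); ring.
rewrite mulrCA mulrA => e; rewrite (_ : (b ^+ 2 - S ^+ 2) / (2 * q) = - c); last by rewrite /c opprK.
rewrite -e; apply: eq_Rintegral => t _; rewrite /f /E /Cs mulrA -expRD.
by congr (expR _ * cos _); rewrite /qd; ring.
Qed.

End parameter.

Lemma gauss_transform q b S a : 0 < q ->
  \int[mu]_t (expR (qd 0 b (- q / 2) t) * cos (qd a S 0 t)) =
  gaussZ q * expR ((b ^+ 2 - S ^+ 2) / (2 * q)) * cos (a + b * S / q).
Proof.
move=> q0; have := gauss_transform_aux b S (a + b * S / q) q0.
by rewrite addrK.
Qed.

End gauss_transform.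

(** * Principal values of modulated Gaussians *)

Section principal_value.
Context {R : realType}.
Implicit Types (b S a t u x : R).
Local Notation mu := (@lebesgue_measure R).
Local Notation Z := (gaussZ (1 : R)).
Local Notation D := ([set~ (0 : R)]).

Let measurable_D : measurable D.
Proof. by apply: measurableC; exact: measurable_set1. Qed.

Lemma Rintegral_setC1 (f : R -> R) : measurable_fun setT f ->
  \int[mu]_(t in D) f t = \int[mu]_t f t.
Proof.
move=> mf; rewrite /Rintegral -setTD integral_setD1_EFin//.
  by apply: measurableD => //; exact: measurable_set1.
by apply/measurable_EFinP; apply: measurable_funS mf.
Qed.

(** The mean value theorem for [exp (u b t) cos (a + u S t)] between [u = 0] and [u = 1]. *)
Lemma expcos_lip b S a t :
  `|expR (b * t) * cos (a + S * t) - cos a| <= (`|b| + `|S|) * `|t| * expR (`|b| * `|t|).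
Proof.
pose h u := expR (qd 0 (b * t) 0 u) * cos (qd a (S * t) 0 u).
have dh u := is_derive_expcos (is_derive_qd 0 (b * t) 0 u) (is_derive_qd a (S * t) 0 u).
have [|u /[!in_itv]/= /andP[u0 u1]] := @MVT _ h _ 0 1 (@ltr01 R) (fun u _ => dh u).
  by apply: continuous_subspaceT; exact: is_derive_continuous dh.
rewrite /h /qd !mulr1 !mulr0 !expr0n /= !mul0r !addr0 !add0r expR0 mul1r subr0 mulr1 => ->.
rewrite normrM ger0_norm ?expR_ge0// mulrC; apply: ler_pM; rewrite ?expR_ge0//.
  apply: le_trans (ler_normB _ _) _; rewrite mulrDl !normrM.
  by apply: lerD; rewrite -[leRHS]mul1r ler_wpM2r ?mulr_ge0 ?norm_cos_le1 ?norm_sin_le1.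
rewrite ler_expR; apply: le_trans (ler_norm _) _; rewrite !normrM.
by rewrite (gtr0_norm u0) ler_piMr// ?mulr_ge0// ltW.
Qed.

(** The subtracted term is an even Gaussian times a constant, so over [t] it has principal value
    zero; removing it makes the quotient bounded near the origin and absolutely integrable. *)
Definition pv_kernel b S a t : R :=
  (expR (qd 0 b (- 1 / 2) t) * cos (qd a S 0 t) - expR (qd 0 0 (- 1 / 2) t) * cos a) / t.

Let K b S := (`|b| + `|S|) * expR ((`|b| + 1) ^+ 2).

Lemma pv_kernel_le b S a t :
  `|pv_kernel b S a t| <= K b S * expR (- (1 / 2) * t ^+ 2 / 2).
Proof.
have K0 : 0 <= K b S by rewrite /K mulr_ge0 ?addr_ge0 ?expR_ge0.
have [->|t0] := eqVneq t 0.
  by rewrite /pv_kernel invr0 mulr0 normr0 mulr_ge0 ?expR_ge0.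
have -> : pv_kernel b S a t =
    expR (- 1 / 2 * t ^+ 2) * (expR (b * t) * cos (a + S * t) - cos a) / t.
  have e1 : expR (qd 0 b (- 1 / 2) t) = expR (- 1 / 2 * t ^+ 2) * expR (b * t).
    by rewrite -expRD; congr expR; rewrite /qd; ring.
  have e2 : qd 0 0 (- 1 / 2) t = - 1 / 2 * t ^+ 2 by rewrite /qd; ring.
  have e3 : qd a S 0 t = a + S * t by rewrite /qd; ring.
  by rewrite /pv_kernel e1 e2 e3; congr (_ / t); ring.
rewrite normrM normrV ?unitfE// ler_pdivrMr ?normr_gt0//.
rewrite normrM ger0_norm ?expR_ge0//.
apply: le_trans (ler_wpM2l (expR_ge0 _) (expcos_lip _ _ _ _)) _.
have h := @gauss_dom R 1 (`|b|) `|t| `|b| ltr01.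
rewrite normr_id in h; move: {h}(h (lexx _)).
rewrite divr1 => h.
have {}h : expR (- 1 / 2 * t ^+ 2) * expR (`|b| * `|t|) <=
    expR ((`|b| + 1) ^+ 2) * expR (- (1 / 2) * t ^+ 2 / 2).
  have e : `|t| ^+ 2 = t ^+ 2 by rewrite real_normK// num_real.
  rewrite e in h; apply: le_trans h; rewrite -expRD.
  rewrite (_ : - 1 / 2 * t ^+ 2 = - 1 * t ^+ 2 / 2); last by ring.
  by rewrite ler_peMr ?expR_ge0// lerDl.
rewrite /K; have w : 0 <= (`|b| + `|S|) * `|t| by rewrite mulr_ge0 ?addr_ge0.
apply: le_trans (le_trans (ler_wpM2l w h) _); rewrite le_eqVlt; apply/orP; left; apply/eqP; ring.
Qed.

Let half_gt0 : 0 < 1 / 2 :> R. Proof. by rewrite divr_gt0. Qed.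

Lemma measurable_invr : measurable_fun setT (@GRing.inv R).
Proof.
have m1 : measurable [set (0 : R)] := measurable_set1 0.
rewrite -(setUv [set (0 : R)]).
apply/(measurable_funU _ m1 measurable_D); split; first exact: measurable_fun_set1.
apply: open_continuous_measurable_fun.
  by apply: closed_openC; apply: accessible_closed_set1; apply: hausdorff_accessible; exact: norm_hausdorff.
by move=> x; rewrite inE => /eqP x0; apply: cvgV => //; exact: cvg_id.
Qed.

Lemma measurable_pv_kernel b S a : measurable_fun setT (pv_kernel b S a).
Proof.
apply: measurable_funM; last first.
  by apply: measurableT_comp => //; exact: measurable_invr.
by apply: measurable_funB; apply: continuous_measurable_real;
  [exact: continuous_expcos|move=> t; apply: cvgM;
   [exact: continuous_comp (@continuous_qd _ _ _ _ t) (@continuous_expR _ _)|exact: cvg_cst]].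
Qed.

Lemma integrable_pv_kernel b S a : mu.-integrable setT (EFin \o pv_kernel b S a).
Proof.
exact: (integrable_le_gauss half_gt0 (measurable_pv_kernel b S a) (pv_kernel_le b S a)).
Qed.

(** The origin is left out because [pv_kernel] is 0 there, by the convention on the inverse of 0,
    whatever the parameters; the formula for its derivative in [b] and [S] holds only for
    [t != 0]. *)
Definition pvX b S a : R := \int[mu]_(t in D) pv_kernel b S a t.

(** Differentiation in [b] or [S] cancels the factor [1 / t] and leaves Gaussian integrals in closed
    form. The affine path covers both parameters at once. *)
Lemma is_derive_pvX b0 b1 S0 S1 a x :
  is_derive x (1:R) (fun x => pvX (b0 + b1 * x) (S0 + S1 * x) a)
   (let b := b0 + b1 * x in let S := S0 + S1 * x in
    Z * expR ((b ^+ 2 - S ^+ 2) / 2) * (b1 * cos (a + b * S) - S1 * sin (a + b * S))).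
Proof.
move=> /=.
pose E y t := expR (qd 0 (b0 + b1 * y) (- 1 / 2) t).
pose f' y t := E y t * (cos (qd a (S0 + S1 * y) 0 t) * b1 - sin (qd a (S0 + S1 * y) 0 t) * S1).
(* The sine is rewritten as a cosine of phase shifted by [- pi / 2], so that [gauss_transform]
   applies to both terms. *)
have f'E y t : f' y t = b1 * (E y t * cos (qd a (S0 + S1 * y) 0 t)) +
    - S1 * (E y t * cos (qd (a - pi / 2) (S0 + S1 * y) 0 t)).
  have -> : qd (a - pi / 2) (S0 + S1 * y) 0 t = qd a (S0 + S1 * y) 0 t - pi / 2 by rewrite /qd; ring.
  by rewrite cosB cos_pihalf sin_pihalf /f'; ring.
have inteq y c : mu.-integrable setT (EFin \o (fun t => E y t * cos (qd c (S0 + S1 * y) 0 t))).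
  exact: integrable_expcos.
pose W := `|x| + 1.
pose B := `|b0| + `|b1| * W.
pose G t := (`|b1| + `|S1|) * expR (0 + (B + 1) ^+ 2 / 1) * expR (- (1 / 2) * t ^+ 2 / 2).
have mf' y : measurable_fun setT (f' y).
  rewrite (_ : f' y = (fun t => b1 * (E y t * cos (qd a (S0 + S1 * y) 0 t)) +
    - S1 * (E y t * cos (qd (a - pi / 2) (S0 + S1 * y) 0 t)))); last exact/funext.
  by apply: measurable_funD; apply: measurable_funM => //;
    apply: continuous_measurable_real; exact: continuous_expcos.
have e : \int[mu]_(t in D) f' x t = Z * expR (((b0 + b1 * x) ^+ 2 - (S0 + S1 * x) ^+ 2) / 2) *
   (b1 * cos (a + (b0 + b1 * x) * (S0 + S1 * x)) - S1 * sin (a + (b0 + b1 * x) * (S0 + S1 * x))).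
  rewrite Rintegral_setC1//; under eq_Rintegral do rewrite f'E.
  rewrite RintegralD//; [|by apply: (integrableZl measurableT _ (inteq x _))..].
  rewrite !RintegralZl//; try exact: inteq.
  rewrite /E !gauss_transform// !divr1 mulr1.
  have -> : a - pi / 2 + (b0 + b1 * x) * (S0 + S1 * x) = a + (b0 + b1 * x) * (S0 + S1 * x) - pi / 2 by ring.
  by rewrite [cos (_ - _)]cosB cos_pihalf sin_pihalf; ring.
rewrite -e; apply: (@is_derive_Rintegral _ _ f' D G).
- exact: measurable_D.
- by move=> y; apply: integrableS (integrable_pv_kernel _ _ _).
- move=> y t /eqP t0.
  have h := is_derive_expcos (is_derive_qd (- 1 / 2 * t ^+ 2 + b0 * t) (b1 * t) 0 y)
       (is_derive_qd (a + S0 * t) (S1 * t) 0 y).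
  have -> : (fun y => pv_kernel (b0 + b1 * y) (S0 + S1 * y) a t) =
    (fun y => t^-1 * (expR (qd (- 1 / 2 * t ^+ 2 + b0 * t) (b1 * t) 0 y) *
       cos (qd (a + S0 * t) (S1 * t) 0 y)) +
       - t^-1 * (expR (qd 0 0 (- 1 / 2) t) * cos a)).
    apply/funext => z; rewrite /pv_kernel.
    have -> : qd 0 (b0 + b1 * z) (- 1 / 2) t = qd (- 1 / 2 * t ^+ 2 + b0 * t) (b1 * t) 0 z by rewrite /qd; ring.
    have -> : qd a (S0 + S1 * z) 0 t = qd (a + S0 * t) (S1 * t) 0 z by rewrite /qd; ring.
    by ring.
  apply: is_derive_eq; rewrite /GRing.scale /= /f' /E.
  have -> : qd 0 (b0 + b1 * y) (- 1 / 2) t = qd (- 1 / 2 * t ^+ 2 + b0 * t) (b1 * t) 0 y by rewrite /qd; ring.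
  have -> : qd a (S0 + S1 * y) 0 t = qd (a + S0 * t) (S1 * t) 0 y by rewrite /qd; ring.
  by field.
- by move=> t; rewrite /G !mulr_ge0 ?expR_ge0// addr_ge0.
- apply: integrableS (_ : mu.-integrable setT _) => //.
  rewrite /G /comp; under eq_fun do rewrite EFinM.
  by apply: integrableZl => //; exact: integrable_gauss.
- move=> y t yx _; have yW : `|y| <= W.
    by rewrite /W -lerBlDl; apply: le_trans (ltW yx); exact: lerB_dist.
  have bB : `|b0 + b1 * y| <= B.
    apply: le_trans (ler_normD _ _) _; rewrite normrM /B lerD2l; exact: ler_wpM2l.
  have h := norm_gauss_lin t ltr01 bB (lexx 0).
  rewrite /f' normrM ger0_norm ?expR_ge0//.
  rewrite /G mulrAC -mulrA mulrC [expR _ * expR _]mulrC; apply: ler_pM; rewrite ?expR_ge0//.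
    apply: le_trans (ler_normB _ _) _; rewrite !normrM.
    by apply: lerD; rewrite -[leRHS]mul1r ler_wpM2r ?norm_cos_le1 ?norm_sin_le1.
  apply: le_trans h; rewrite /E ler_peMr ?expR_ge0// lerDl//.
Qed.

Lemma pvX00 a : pvX 0 0 a = 0.
Proof.
rewrite /pvX (_ : pv_kernel 0 0 a = fun=> 0) ?Rintegral_cst ?mul0r//.
apply/funext => t; rewrite /pv_kernel (_ : qd a 0 0 t = a) ?subrr ?mul0r//.
by rewrite /qd; ring.
Qed.

(** This is the integral of [exp (- t^2 / 2) sin (S t) / t]: odd and increasing in [S], with a
    Gaussian derivative, a smooth version of a multiple of the sign. *)
Definition pvV S : R := pvX 0 S (- (pi / 2)).

Lemma is_derive_pvX0 a S :
  is_derive S (1:R) (fun S => pvX 0 S a) (- (Z * expR (- S ^+ 2 / 2) * sin a)).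
Proof.
have := is_derive_pvX 0 0 0 1 a S.
rewrite /= !mul0r !addr0 !add0r mul1r mul0r addr0 expr0n/= sub0r.
under eq_fun do rewrite mul0r addr0 mul1r add0r.
by rewrite mul1r mulrN.
Qed.

Lemma is_derive_pvV S : is_derive S (1:R) pvV (Z * expR (- S ^+ 2 / 2)).
Proof.
have := is_derive_pvX0 (- (pi / 2)) S.
by rewrite sinN sin_pihalf mulrN1 opprK.
Qed.

(** The even part of [cos (a + S t)] contributes nothing. Formally, both sides vanish at [S = 0] and
    have the same derivative in [S]. *)
Lemma pvX0E S a : pvX 0 S a = - sin a * pvV S.
Proof.
apply/eqP; rewrite -subr_eq0; apply/eqP.
pose h S := pvX 0 S a + sin a * pvV S.
have -> : pvX 0 S a - - sin a * pvV S = h S by rewrite /h; ring.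
have -> : h S = h 0; last by rewrite /h /pvV !pvX00 mulr0 addr0.
apply: derive0_cst => x; rewrite /h.
have ? := is_derive_pvX0 a x; have ? := is_derive_pvV x.
by apply: is_derive_eq; rewrite /GRing.scale/=; ring.
Qed.

Lemma pvVN S : pvV (- S) = - pvV S.
Proof.
apply/eqP; rewrite -subr_eq0 opprK; apply/eqP.
pose h S := pvV (- S) + pvV S.
have -> : pvV (- S) + pvV S = h S by [].
have -> : h S = h 0; last by rewrite /h oppr0 /pvV !pvX00 addr0.
apply: derive0_cst => x; rewrite /h.
have d1 := is_derive_pvV x; have d2 := is_derive_pvV (- x).
have d3 : is_derive x (1:R) (-%R) (- 1 : R) by apply: is_derive_eq.
have d4 := is_derive1_comp d2 d3.
rewrite (_ : (fun S => pvV (- S) + pvV S) = (pvV \o -%R) + pvV)//.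
by apply: is_derive_eq; rewrite sqrrN; ring.
Qed.

(** The mean value theorem in [b]. The growth [exp (b^2 / 2)] is harmless: later [b] is the
    component of [x] along [v], and the test function carries [exp (- |x|^2 / 2)]. *)
Lemma pvX_dist b S a :
  `|pvX b S a - pvX 0 S a| <= `|b| * (Z * expR ((b ^+ 2 - S ^+ 2) / 2)).
Proof.
pose h x := pvX (0 + b * x) (S + 0 * x) a.
have dh x : is_derive x (1 : R) h _ := is_derive_pvX 0 b S 0 a x.
have [|u /[!in_itv]/= /andP[u0 u1]] := @MVT _ h _ 0 1 (@ltr01 R) (fun u _ => dh u).
  by apply: continuous_subspaceT; exact: is_derive_continuous dh.
have -> : h 1 = pvX b S a by rewrite /h mulr1 mul0r add0r addr0.
have -> : h 0 = pvX 0 S a by rewrite /h !mulr0 !addr0.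
rewrite mul0r addr0 add0r !subr0 mulr1 mul0r subr0 => ->.
rewrite normrM [leRHS]mulrC; apply: ler_pM; rewrite ?normr_ge0//.
  rewrite ger0_norm ?mulr_ge0 ?expR_ge0// ?(ltW (gaussZ_gt0 _))//.
  apply: ler_wpM2l; first by rewrite (ltW (gaussZ_gt0 _)).
  rewrite ler_expR ler_pM2r// lerD2r exprMn ler_piMr ?sqr_ge0//.
  by rewrite expr_le1 ?ltW.
by rewrite normrM ler_piMr ?norm_cos_le1.
Qed.

Lemma le_derive (f f' : R -> R) (x y : R) : (forall u, is_derive u (1:R) f (f' u)) ->
  (forall u, 0 <= f' u) -> x <= y -> f x <= f y.
Proof.
move=> df f0; rewrite le_eqVlt => /predU1P[->//|xy].
have [|u _] := @MVT _ f f' x y xy (fun u _ => df u).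
  by apply: continuous_subspaceT; exact: is_derive_continuous df.
by move=> e; rewrite -subr_ge0 e mulr_ge0// subr_ge0 ltW.
Qed.

Lemma pvV_le S S' : S <= S' -> pvV S <= pvV S'.
Proof.
apply: le_derive is_derive_pvV _ => u.
by rewrite mulr_ge0 ?expR_ge0// ltW// gaussZ_gt0.
Qed.

(** The derivative of [pvV] is at most [Z exp (1 / 2 - u)], since [(u - 1)^2 >= 0]; the exponential
    has an explicit primitive. *)
Lemma pvV_tail S S' : S <= S' -> pvV S' <= pvV S + Z * expR (1 / 2 - S).
Proof.
move=> SS'; pose h S := - pvV S - Z * expR (1 / 2 - S).
have dh u : is_derive u (1:R) h (Z * (expR (1 / 2 - u) - expR (- u ^+ 2 / 2))).
  have ? := is_derive_pvV u.
  by rewrite /h; apply: is_derive_eq; rewrite /GRing.scale/=; ring.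
have := le_derive dh _ SS'; rewrite /h => H.
have {}H : - pvV S - Z * expR (1 / 2 - S) <= - pvV S' - Z * expR (1 / 2 - S').
  apply: H => u; apply: mulr_ge0; first by rewrite ltW// gaussZ_gt0.
  rewrite subr_ge0 ler_expR -subr_ge0.
  have -> : 1 / 2 - u - - u ^+ 2 / 2 = (u - 1) ^+ 2 / 2 by field.
  by rewrite divr_ge0 ?sqr_ge0.
have := expR_ge0 (1 / 2 - S'); have := gaussZ_gt0 (@ltr01 R) => z0 e0.
have := mulr_ge0 (ltW z0) e0; lra.
Qed.

(** The constant [k] is the supremum of [pvV], that is, its limit at infinity; [pvV_tail] gives the
    rate and oddness the negative side. *)
Lemma pvV_lim : exists2 k : R, 0 < k &
  forall S, `|Num.sg S * k - pvV S| <= k * (S == 0)%:R + Z * expR (1 / 2 - `|S|).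
Proof.
pose A := range pvV.
have V0 : pvV 0 = 0 by rewrite /pvV pvX00.
have ub S : pvV S <= Z * expR (1 / 2).
  have [S0|S0] := leP 0 S; first by have := pvV_tail S0; rewrite V0 add0r subr0.
  apply: le_trans (pvV_le (ltW S0)) _; rewrite V0.
  by rewrite mulr_ge0 ?expR_ge0// ltW// gaussZ_gt0.
have hs : has_sup A.
  by split; [exists (pvV 0), 0|exists (Z * expR (1 / 2)) => _ [S _ <-]].
have Vk S : pvV S <= sup A by apply: ub_le_sup; [case: hs|exists S].
have kV S : sup A <= pvV S + Z * expR (1 / 2 - S).
  apply: ge_sup; first by case: hs.
  move=> _ [S' _ <-]; have [SS'|S'S] := leP S S'; first exact: pvV_tail.
  apply: le_trans (pvV_le (ltW S'S)) _; rewrite lerDl.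
  by rewrite mulr_ge0 ?expR_ge0// ltW// gaussZ_gt0.
exists (sup A).
  apply: lt_le_trans (Vk 1).
  have d := is_derive_pvV.
  have [|u _] := @MVT _ pvV _ 0 1 (@ltr01 R) (fun u _ => d u).
    by apply: continuous_subspaceT; exact: is_derive_continuous d.
  by rewrite V0 !subr0 mulr1 => ->; rewrite mulr_gt0 ?expR_gt0 ?gaussZ_gt0.
move=> S; have [S0|S0|->] := ltgtP S 0.
- rewrite ltr0_sg// mulN1r (ltr0_norm S0).
  have := Vk (- S); have := kV (- S); rewrite pvVN opprK mulr0 add0r.
  by rewrite ler_norml => ? ?; apply/andP; split; lra.
- rewrite gtr0_sg// mul1r (gtr0_norm S0) mulr0 add0r.
  have := Vk S; have := kV S.
  by rewrite ler_norml => ? ?; apply/andP; split; lra.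
- rewrite sgr0 mul0r V0 subrr normr0 mulr1 addr_ge0//.
    by rewrite -V0; exact: Vk.
  by rewrite mulr_ge0 ?expR_ge0// ltW// gaussZ_gt0.
Qed.

(** The sign condition makes the reflection a change of variables between nonnegative integrands. *)
Lemma Rintegral_odd (g : R -> R) : mu.-integrable setT (EFin \o g) ->
  (forall t, g (- t) = - g t) -> (forall t, 0 <= t -> 0 <= g t) ->
  \int[mu]_t g t = 0.
Proof.
move=> intg og g0; have mg := measurable_int _ intg.
have mgR : measurable_fun setT g by exact/measurable_EFinP.
pose g1 t : \bar R := (g `|t|)%:E.
have mg1 : measurable_fun setT g1.
  by apply/measurable_EFinP; exact: measurableT_comp mgR (@normr_measurable _ _).
have sub1 := ge0_integration_by_substitution0 mg1 (fun r => _ : (0%:E <= g1 r)%E).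
have {}sub1 : (\int[mu]_(r in `[0%R, +oo[) g1 r)%E = (\int[mu]_(r in `]-oo, 0%R]) g1 (- r)%R)%E.
  by apply: sub1 => r; rewrite lee_fin g0.
have -> : [set: R] = `]-oo, 0]%classic `|` `]0, +oo[%classic.
  by rewrite (itv_setU_setT false (0 : R)).
rewrite Rintegral_setU//; last 2 first.
- by rewrite (itv_setU_setT false (0 : R)).
- apply/disj_setPS => t /= []; rewrite !in_itv/= andbT => /le_lt_trans h /h; by rewrite ltxx.
rewrite [X in _ + X]Rintegral_itv_obnd_cbnd; last by apply: integrableS intg.
rewrite /Rintegral.
have -> : (\int[mu]_(x in `[0%R, +oo[) (g x)%:E)%E = (\int[mu]_(r in `[0%R, +oo[) g1 r)%E.
  by apply: eq_integral => t; rewrite inE/= in_itv/= andbT => t0; rewrite /g1 ger0_norm.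
have -> : (\int[mu]_(x in `]-oo, 0%R]) (g x)%:E)%E = (- \int[mu]_(r in `]-oo, 0%R]) g1 (- r)%R)%E.
  rewrite -integral_ge0N//; last by move=> t _; rewrite lee_fin g0.
  apply: eq_integral => t; rewrite inE/= in_itv/= => t0.
  by rewrite /g1 ger0_norm ?oppr_ge0// og opprK.
by rewrite -sub1 fineN addNr.
Qed.

(** On [|t| > eps] the odd function [exp (- t^2 / 2) / t] has integral zero, so the truncated
    integral is that of [pv_kernel], which is integrable across the origin. *)
Lemma cvg_pv b S a :
  (\int[mu]_(t in [set t | eps < `|t|])
     (expR (qd 0 b (- 1 / 2) t) * cos (qd a S 0 t) / t)) @[eps --> 0^'+] --> pvX b S a.
Proof.
apply/cvgrPdist_le => e e0.
have K0 : 0 <= K b S by rewrite /K mulr_ge0 ?addr_ge0 ?expR_ge0.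
have K1 : 0 < K b S *+ 2 + 1 by rewrite ltr_wpDl// mulrn_wge0.
(* The part over [[-eps, eps]] is at most [2 eps K], hence at most [e] below this threshold; the
   [+ 1] keeps the denominator positive when [K] vanishes. *)
have d0 : 0 < e / (K b S *+ 2 + 1) by rewrite divr_gt0.
near=> eps.
have eps0 : 0 < eps by near: eps; exact: nbhs_right_gt.
pose A := [set t : R | eps < `|t|].
pose B : set R := `[- eps, eps]%classic.
have AB : A = ~` B.
  by apply/seteqP; split => t; rewrite /A /B /= in_itv/= -ler_norml ltNge => /negP.
have mB : measurable B by exact: measurable_itv.
have mA : measurable A by rewrite AB; exact: measurableC.
pose g t := expR (qd 0 0 (- 1 / 2) t) / t.
have mg : measurable_fun setT g.
  apply: measurable_funM; last first.
    by apply: measurableT_comp => //; exact: measurable_invr.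
  by apply: continuous_measurable_real => t;
    exact: continuous_comp (@continuous_qd _ _ _ _ t) (@continuous_expR _ _).
have intg : mu.-integrable setT (EFin \o (g \_ A)).
  apply: (@integrable_le_gauss _ _ 1 eps^-1) => //.
    by apply/(measurable_restrictT _ mA); apply: measurable_funS mg.
  move=> t; rewrite patchE; case: ifPn; last by rewrite normr0 mulr_ge0 ?expR_ge0// invr_ge0 ltW.
  rewrite inE /A/= => et; rewrite /g normrM ger0_norm ?expR_ge0// mulrC.
  apply: ler_pM; rewrite ?expR_ge0//.
    have t1 : 0 < `|t| := lt_trans eps0 et.
    by rewrite normfV lef_pV2 ?posrE//; exact: ltW.
  by rewrite ler_expR /qd; lra.
have intgA : mu.-integrable A (EFin \o g).
  have i2 : mu.-integrable A (EFin \o (g \_ A)) by apply: integrableS intg.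
  have h := @eq_integrable _ _ _ mu A mA (EFin \o (g \_ A)) (EFin \o g).
  by apply: h => // t tA; rewrite /= patchE tA.
have gA0 : \int[mu]_(t in A) g t = 0.
  rewrite Rintegral_mkcond; apply: Rintegral_odd => // t.
    have E : (- t \in A) = (t \in A).
      by apply/idP/idP => /set_mem h; apply/mem_set; move: h; rewrite /A/= normrN.
    rewrite !patchE E.
    by case: ifPn => _; rewrite ?oppr0// /g /qd sqrrN invrN !mul0r mulrN.
  by move=> t0; rewrite patchE; case: ifPn => // _; rewrite /g divr_ge0 ?expR_ge0.
have intk := integrable_pv_kernel b S a.
have -> : \int[mu]_(t in A) (expR (qd 0 b (- 1 / 2) t) * cos (qd a S 0 t) / t) =
    \int[mu]_(t in A) pv_kernel b S a t.
  transitivity (\int[mu]_(t in A) (pv_kernel b S a t + cos a * g t)).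
    by apply: eq_Rintegral => t _; rewrite /pv_kernel /g; ring.
  rewrite RintegralD//; first by rewrite RintegralZl// gA0 mulr0 addr0.
    by apply: integrableS intk.
  have h := @integrableZl _ _ _ mu A mA (cos a) (EFin \o g) intgA; exact: h.
have -> : pvX b S a = \int[mu]_(t in A) pv_kernel b S a t + \int[mu]_(t in B) pv_kernel b S a t.
  rewrite /pvX Rintegral_setC1; last exact: measurable_pv_kernel.
  rewrite -Rintegral_setU//.
  - by rewrite AB setUC setUv.
  - by rewrite AB setUC setUv.
  - by rewrite AB; exact/disj_setPCr.
rewrite addrC addKr.
have intB : mu.-integrable B (EFin \o pv_kernel b S a) by apply: integrableS intk.
have h1 := @le_normr_Rintegral _ _ _ mu B (pv_kernel b S a) mB intB; apply: (le_trans h1) => {h1}.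
have muB : mu (`[- eps, eps]%classic : set R) = (eps *+ 2)%:E.
  by rewrite lebesgue_measure_itv/= lte_fin gtrN// -EFinB /= opprK mulr2n.
apply: (@le_trans _ _ (\int[mu]_(t in B) K b S)).
  apply: (@le_Rintegral _ _ _ mu B _ _ mB).
  - exact: (@integrable_norm _ _ _ mu B (pv_kernel b S a) intB).
  - apply: measurable_bounded_integrable => //.
      by rewrite [X in (X < _)%E](_ : _ = (eps *+ 2)%:E) ?ltry//; exact: muB.
    exact: bounded_cst.
  - move=> t _; apply: le_trans (pv_kernel_le _ _ _ _) _.
    rewrite ler_piMr// expR_le1 mulNr mulNr oppr_le0.
    by rewrite divr_ge0// mulr_ge0 ?sqr_ge0// divr_ge0.
rewrite Rintegral_cst//.
have -> : fine (mu B) = eps *+ 2.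
  by rewrite [X in fine X](_ : _ = (eps *+ 2)%:E)//; exact: muB.
have : eps < e / (K b S *+ 2 + 1).
  by near: eps; exact: nbhs_right_lt.
rewrite ltr_pdivlMr//.
by rewrite mulrnAr -mulrnAl mulrC => h; lra.
Unshelve. all: by end_near. Qed.

End principal_value.

(** * Gaussian integrals in n variables *)

Section tuple_gauss.
Context {R : realType}.
Local Notation TR := (measurableTypeR R).
Local Notation mu := (@lebesgue_measure R).
Local Notation leb n := (@lebesgue_tuple R n).

Lemma EFin_Rintegral d (T : measurableType d) (m : {measure set T -> \bar R})
    (f : T -> R) : m.-integrable setT (EFin \o f) ->
  (\int[m]_x (f x)%:E)%E = (\int[m]_x f x)%:E.
Proof. by move=> intf; rewrite /Rintegral fineK//; exact: integrable_fin_num. Qed.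

(** Fubini for one coordinate: the measure is the push-forward of a product under [tcons]. The new
    coordinate is integrated innermost, which suits an induction on [n]. *)
Lemma lebesgue_tupleS n (f : n.+1.-tuple TR -> R) :
  measurable_fun setT f ->
  (mu \x leb n)%E.-integrable setT (EFin \o f \o @tcons R n) ->
  (leb n.+1).-integrable setT (EFin \o f) /\
  (\int[leb n.+1]_t (f t)%:E)%E = (\int[leb n]_t \int[mu]_x (f (tcons (x, t)))%:E)%E.
Proof.
move=> mf intf.
have mfE : measurable_fun setT (EFin \o f) by exact/measurable_EFinP.
have intp := integrable_pushforward (@measurable_tcons R n) mfE intf measurableT.
have ep := integral_pushforward (@measurable_tcons R n) mfE intf measurableT.
split.
  apply/integrableP; split => //.
  have /integrableP[_] := intp; apply: le_lt_trans.
  rewrite le_eqVlt; apply/orP; left; apply/eqP; apply: eq_measure_integral => [|? A _ _].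
    exact: measurable_tcons.
  exact: erefl.
transitivity (\int[(mu \x leb n)%E]_z ((EFin \o f) \o @tcons R n) z)%E.
  rewrite preimage_setT in ep; rewrite -ep; apply: eq_measure_integral => [|? A _ _]; [exact: measurable_tcons|exact: erefl].
by rewrite -integral21_prod_meas1.
Qed.

Definition tdot n (w : 'I_n -> R) (t : n.-tuple TR) : R := \sum_(i < n) w i * tnth t i.
Definition tsq n (t : n.-tuple TR) : R := \sum_(i < n) tnth t i ^+ 2.

Lemma tdotS n (w : 'I_n.+1 -> R) x (t : n.-tuple TR) :
  tdot w (tcons (x, t)) = w ord0 * x + tdot (fun i => w (lift ord0 i)) t.
Proof.
rewrite /tdot big_ord_recl tnth0; congr (_ + _).
by apply: eq_bigr => i _; rewrite tnthS; congr (_ * _); congr tnth; exact: val_inj.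
Qed.

Lemma tsqS n x (t : n.-tuple TR) : tsq (tcons (x, t)) = x ^+ 2 + tsq t.
Proof.
rewrite /tsq big_ord_recl tnth0; congr (_ + _).
by apply: eq_bigr => i _; rewrite tnthS; congr (_ ^+ _); congr tnth; exact: val_inj.
Qed.

Lemma measurable_tdot n (w : 'I_n -> R) : measurable_fun setT (@tdot n w).
Proof.
apply: measurable_sum => i; apply: measurable_funM => //; exact: measurable_tnth.
Qed.

Lemma measurable_tsq n : measurable_fun setT (@tsq n).
Proof.
by apply: measurable_sum => i; apply: measurable_funX; exact: measurable_tnth.
Qed.

Definition tgauss n q (t : n.-tuple TR) : R := expR (- q * tsq t / 2).

Lemma measurable_tgauss n q : measurable_fun setT (@tgauss n q).
Proof.
apply: measurableT_comp => //; apply: measurable_funM => //.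
by apply: measurable_funM => //; exact: measurable_tsq.
Qed.

Lemma tgaussS n q x (t : n.-tuple TR) :
  tgauss q (tcons (x, t)) = expR (- q * x ^+ 2 / 2) * tgauss q t.
Proof. by rewrite /tgauss tsqS -expRD; congr expR; ring. Qed.

Lemma measurable_tgauss_cos n q (w : 'I_n -> R) a :
  measurable_fun setT (fun t => tgauss q t * cos (a + tdot w t)).
Proof.
apply: measurable_funM; first exact: measurable_tgauss.
apply: measurableT_comp; first by apply: continuous_measurable_real; exact: continuous_cos.
by apply: measurable_funD => //; exact: measurable_tdot.
Qed.

(** The free phase [a] carries the induction: while the first coordinate is integrated, the
    remaining part of the scalar product is absorbed into the phase, so no sine integral has to be
    carried along. *)
Lemma tuple_gauss n q : 0 < q -> forall (w : 'I_n -> R) a,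
  (leb n).-integrable setT (EFin \o (fun t => tgauss q t * cos (a + tdot w t))) /\
  \int[leb n]_t (tgauss q t * cos (a + tdot w t)) =
  gaussZ q ^+ n * expR (- (\sum_(i < n) w i ^+ 2) / (2 * q)) * cos a.
Proof.
move=> q0; elim: n => [|n IH] w a.
  have e t : tgauss q t * cos (a + tdot w t) = cos a.
    by rewrite /tgauss /tdot /tsq !big_ord0 mulr0 mul0r expR0 mul1r addr0.
  rewrite big_ord0 oppr0 mul0r expR0 expr0 !mul1r /=; split.
    apply/integrableP; split; first by apply/measurable_EFinP; exact: measurable_tgauss_cos.
    rewrite integral_dirac// ?diracT ?mul1e ?ltry//.
    by apply: measurableT_comp => //; apply/measurable_EFinP; exact: measurable_tgauss_cos.
  rewrite /Rintegral integral_dirac// ?diracT ?mul1e ?e//.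
  by apply/measurable_EFinP; exact: measurable_tgauss_cos.
set f := fun t => _.
have mf : measurable_fun setT f by exact: measurable_tgauss_cos.
have intG : (leb n).-integrable setT (EFin \o (fun t => tgauss q t)).
  have [h _] := IH (fun=> 0) 0.
  apply: (eq_integrable measurableT _ _ _ h) => t _ /=.
  by rewrite (_ : tdot _ t = 0) ?addr0 ?cos0 ?mulr1// /tdot big1// => i _; rewrite mul0r.
pose H (z : TR * n.-tuple TR) := expR (- q * z.1 ^+ 2 / 2) * tgauss q z.2.
have mH : measurable_fun setT H.
  apply: measurable_funM.
    apply: (@measurableT_comp _ _ _ _ _ _ (fun x : R => expR (- q * x ^+ 2 / 2)) _ fst) => //.
    by have /measurable_int/measurable_EFinP := integrable_gauss q0.
  exact: measurableT_comp (@measurable_tgauss n q) measurable_snd.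
have intH : (mu \x leb n)%E.-integrable setT (EFin \o H).
  apply/integrable21ltyP; first exact/measurable_EFinP.
  rewrite (_ : (fun y => _) = (fun y => (gaussZ q * tgauss q y)%:E)); last first.
    apply/funext => y.
    rewrite (_ : (fun x => _) = (fun x => (tgauss q y)%:E * (expR (- q * x ^+ 2 / 2))%:E)%E); last first.
      by apply/funext => x; rewrite /H/= ger0_norm ?mulr_ge0 ?expR_ge0// EFinM muleC.
    rewrite integralZl//; last exact: integrable_gauss.
    by rewrite EFin_Rintegral ?EFinM 1?muleC//; exact: integrable_gauss.
  under eq_integral do rewrite EFinM.
  by rewrite integralZl// EFin_Rintegral// -EFinM ltry.
have intf : (mu \x leb n)%E.-integrable setT (EFin \o f \o @tcons R n).
  apply: (le_integrable measurableT _ _ intH).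
    by apply/measurable_EFinP; exact: measurableT_comp mf (@measurable_tcons R n).
  move=> [x t] _ /=; rewrite lee_fin /f /H /= tgaussS normrM.
  by rewrite [leRHS]ger0_norm ?mulr_ge0 ?expR_ge0// (ger0_norm (mulr_ge0 _ _)) ?expR_ge0// ler_piMr ?mulr_ge0 ?expR_ge0 ?norm_cos_le1.
have [i1 e1] := lebesgue_tupleS mf intf; split => //.
pose w' i := w (lift ord0 i).
rewrite /Rintegral e1.
have e2 t : (\int[mu]_x (f (tcons (x, t)))%:E)%E =
   ((gaussZ q * expR (- w ord0 ^+ 2 / (2 * q))) * (tgauss q t * cos (a + tdot w' t)))%:E.
  have inte : mu.-integrable setT (EFin \o (fun x => expR (qd 0 0 (- q / 2) x) * cos (qd (a + tdot w' t) (w ord0) 0 x))).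
    exact: integrable_expcos.
  transitivity (\int[mu]_x ((tgauss q t)%:E * (expR (qd 0 0 (- q / 2) x) * cos (qd (a + tdot w' t) (w ord0) 0 x))%:E))%E.
    apply: eq_integral => x _; rewrite -EFinM /f tgaussS tdotS; congr EFin.
    rewrite (_ : qd 0 0 (- q / 2) x = - q * x ^+ 2 / 2); last by rewrite /qd; ring.
    rewrite (_ : qd _ _ _ x = a + (w ord0 * x + tdot w' t)); last by rewrite /qd; ring.
    by ring.
  rewrite integralZl// EFin_Rintegral// gauss_transform// -EFinM; congr EFin.
  rewrite expr0n/= sub0r mul0r mul0r addr0; ring.
under eq_integral do rewrite e2 EFinM.
have [h1 h2] := IH w' a.
rewrite integralZl// EFin_Rintegral// h2 -EFinM [LHS]/=.
rewrite [\sum_(i < n.+1) _]big_ord_recl -/w' [gaussZ q ^+ n.+1]exprS.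
have -> : - (w ord0 ^+ 2 + \sum_(i < n) w (lift ord0 i) ^+ 2) / (2 * q) =
    - w ord0 ^+ 2 / (2 * q) + - (\sum_(i < n) w' i ^+ 2) / (2 * q) by rewrite /w'; ring.
by rewrite expRD; ring.
Qed.

End tuple_gauss.

(** * Trigonometric polynomials in two variables and their means *)

Section trig_lists.
Context {R : realType}.
Implicit Types (c p q a s t x y z M : R).

(* A list of [(c, p, q, a)] stands for the sum of [c cos (p y + q z + a)]. *)
Definition term : Type := (R * R * R * R)%type.
Definition trig := seq term.
Implicit Types (A B T : trig).

Definition ev1 (m : term) y z := let: (c, p, q, a) := m in c * cos (p * y + q * z + a).
Definition ev T y z := \sum_(m <- T) ev1 m y z.
Definition mean1 (m : term) :=
  let: (c, p, q, a) := m in if (p == 0) && (q == 0) then c * cos a else 0.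
Definition mean T := \sum_(m <- T) mean1 m.

Definition scaleT x T : trig := [seq let: (c, p, q, a) := m in (x * c, p, q, a) | m <- T].
Definition dilT M T : trig := [seq let: (c, p, q, a) := m in (c, M * p, M * q, a) | m <- T].
(* The frequency of the second factor carries the sign [+] in both terms, so
   that it determines the half-plane of the product when it is large. *)
Definition mul1 (m m' : term) : trig :=
  let: (c, p, q, a) := m in let: (c', p', q', a') := m' in
  [:: (c * c' / 2, p' + p, q' + q, a' + a); (c * c' / 2, p' - p, q' - q, a' - a)].
Definition mulT A B : trig := flatten [seq flatten [seq mul1 m m' | m' <- B] | m <- A].
(** The conjugate function relative to the half-plane [p s + q > 0]: each cosine becomes a sine with
    the sign of its half-plane, and frequencies on the boundary line are killed. *)
Definition conjT s T : trig :=
  [seq let: (c, p, q, a) := m in (Num.sg (p * s + q) * c, p, q, a - pi / 2) | m <- T].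
(** The value of [conjT s] when all frequencies lie in the positive half-plane; it no longer depends
    on [s]. *)
Definition hatT T : trig := [seq let: (c, p, q, a) := m in (c, p, q, a - pi / 2) | m <- T].
(** The partial derivative in [y], in formal terms; [mean_der] then plays the role of integration by
    parts. *)
Definition derT T : trig := [seq let: (c, p, q, a) := m in (p * c, p, q, a + pi / 2) | m <- T].
Definition constT c : trig := [:: (c, 0, 0, 0)].

Lemma cosBpihalf x : cos (x - pi / 2) = sin x.
Proof. by rewrite cosB cos_pihalf sin_pihalf mulr0 mulr1 add0r. Qed.

Lemma cosDpihalf' x : cos (x + pi / 2) = - sin x.
Proof. by rewrite cosD cos_pihalf sin_pihalf mulr0 mulr1 sub0r. Qed.

Lemma evD A B y z : ev (A ++ B) y z = ev A y z + ev B y z.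
Proof. by rewrite /ev big_cat. Qed.

Lemma ev_nil y z : ev [::] y z = 0. Proof. by rewrite /ev big_nil. Qed.

Lemma evZ x T y z : ev (scaleT x T) y z = x * ev T y z.
Proof.
rewrite /ev big_map mulr_sumr; apply: eq_bigr => -[[[c p] q] a] _ /=; ring.
Qed.

Lemma ev_dil M T y z : ev (dilT M T) y z = ev T (M * y) (M * z).
Proof.
rewrite /ev big_map; apply: eq_bigr => -[[[c p] q] a] _ /=.
by congr (_ * cos _); ring.
Qed.

Lemma ev_const c y z : ev (constT c) y z = c.
Proof. by rewrite /ev big_seq1 /= !mul0r !addr0 cos0 mulr1. Qed.

Lemma big_mulT (V : nmodType) (F : term -> V) A B :
  \sum_(m <- mulT A B) F m =
  \sum_(m <- A) \sum_(m' <- B) \sum_(k <- mul1 m m') F k.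
Proof.
rewrite /mulT big_flatten big_map; apply: eq_bigr => m _.
by rewrite big_flatten big_map.
Qed.

Lemma evM A B y z : ev (mulT A B) y z = ev A y z * ev B y z.
Proof.
rewrite /ev big_mulT mulr_suml; apply: eq_bigr => m _.
rewrite mulr_sumr; apply: eq_bigr => m' _.
case: m => [[[c p] q] a]; case: m' => [[[c' p'] q'] a'] /=.
rewrite big_cons big_seq1 /=.
have -> : (p' + p) * y + (q' + q) * z + (a' + a) = (p' * y + q' * z + a') + (p * y + q * z + a) by ring.
have -> : (p' - p) * y + (q' - q) * z + (a' - a) = (p' * y + q' * z + a') - (p * y + q * z + a) by ring.
by rewrite cosD cosB; field.
Qed.

Lemma ev_der_mul A B y z :
  ev (derT (mulT A B)) y z = ev (derT A) y z * ev B y z + ev A y z * ev (derT B) y z.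
Proof.
rewrite /ev !big_map big_mulT !mulr_suml -big_split; apply: eq_bigr => m _ /=.
rewrite !mulr_sumr -big_split; apply: eq_bigr => m' _ /=.
case: m => [[[c p] q] a]; case: m' => [[[c' p'] q'] a'] /=.
rewrite big_cons big_seq1 /=.
have -> : (p' + p) * y + (q' + q) * z + (a' + a + pi / 2) =
  (p' * y + q' * z + a') + (p * y + q * z + a) + pi / 2 by ring.
have -> : (p' - p) * y + (q' - q) * z + (a' - a + pi / 2) =
  (p' * y + q' * z + a') - (p * y + q * z + a) + pi / 2 by ring.
rewrite ![_ * _ + _ * _ + (_ + pi / 2)]addrA.
set U := p' * y + q' * z + a'; set V := p * y + q * z + a.
rewrite !cosDpihalf' [sin (U + V)]sinD [sin (U - V)]sinB.
by field.
Qed.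

Lemma meanD A B : mean (A ++ B) = mean A + mean B.
Proof. by rewrite /mean big_cat. Qed.

Lemma mean_nil : mean [::] = 0. Proof. by rewrite /mean big_nil. Qed.

Lemma meanZ x T : mean (scaleT x T) = x * mean T.
Proof.
rewrite /mean big_map mulr_sumr; apply: eq_bigr => -[[[c p] q] a] _ /=.
by case: ifP; rewrite ?mulr0// mulrA.
Qed.

Lemma mean_const c : mean (constT c) = c.
Proof. by rewrite /mean big_seq1 /= eqxx /= cos0 mulr1. Qed.

Lemma mean_der T : mean (derT T) = 0.
Proof.
rewrite /mean big_map big1// => -[[[c p] q] a] _ /=.
by case: ifP => // /andP[/eqP-> _]; rewrite mul0r mul0r.
Qed.

Section gauss_mean.
Variables (n : nat) (i l : 'I_n) (il : i != l) (q0 : R) (q0_gt0 : 0 < q0).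
Local Notation leb := (@lebesgue_tuple R n).
Local Notation vec p q M := (fun k : 'I_n => M * (p * (k == i)%:R + q * (k == l)%:R)).

Lemma tdot_vec p q M (t : n.-tuple (measurableTypeR R)) :
  tdot (vec p q M) t = p * (M * tnth t i) + q * (M * tnth t l).
Proof.
have D (k : 'I_n) (F : 'I_n -> R) : \sum_j (j == k)%:R * F j = F k.
  rewrite (bigD1 k)//= eqxx mul1r big1 ?addr0// => j /negbTE ->; exact: mul0r.
rewrite /tdot.
transitivity (\sum_j (j == i)%:R * (p * M * tnth t j) + \sum_j (j == l)%:R * (q * M * tnth t j)).
  by rewrite -big_split; apply: eq_bigr => j _ /=; ring.
by rewrite !D; ring.
Qed.

Lemma sumsq_vec p q M : \sum_k (vec p q M k) ^+ 2 = M ^+ 2 * (p ^+ 2 + q ^+ 2).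
Proof.
have li : (l == i) = false by rewrite eq_sym (negbTE il).
rewrite (bigD1 i)//= (bigD1 l)/=; last by rewrite li.
rewrite !eqxx (negbTE il) li big1 ?addr0 /=; first by ring.
by move=> k /andP[/negbTE -> /negbTE ->]; rewrite !mulr0 addr0 mulr0 expr0n.
Qed.

Definition gavg T M : R := \int[leb]_t (tgauss q0 t * ev T (M * tnth t i) (M * tnth t l)).

Lemma gavg1 (m : term) M :
  leb.-integrable setT (EFin \o (fun t : n.-tuple (measurableTypeR R) => tgauss q0 t * ev1 m (M * tnth t i) (M * tnth t l))) /\
  \int[leb]_t (tgauss q0 t * ev1 m (M * tnth t i) (M * tnth t l)) =
  let: (c, p, q, a) := m in
  gaussZ q0 ^+ n * (c * (expR (- (M ^+ 2 * (p ^+ 2 + q ^+ 2)) / (2 * q0)) * cos a)).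
Proof.
case: m => [[[c p] q] a].
have [h1 h2] := tuple_gauss q0_gt0 (vec p q M) a.
have e (t : n.-tuple (measurableTypeR R)) : tgauss q0 t * ev1 (c, p, q, a) (M * tnth t i) (M * tnth t l) =
   c * (tgauss q0 t * cos (a + tdot (vec p q M) t)).
  by rewrite tdot_vec /= [a + _]addrC; ring.
split.
  apply: (eq_integrable measurableT _ _ _ (integrableZl measurableT c h1)) => t _ /=.
  by rewrite -EFinM e.
under eq_Rintegral do rewrite e.
by rewrite RintegralZl// h2 sumsq_vec; ring.
Qed.

Lemma integrable_gauss_ev T M :
  leb.-integrable setT (EFin \o (fun t : n.-tuple (measurableTypeR R) => tgauss q0 t * ev T (M * tnth t i) (M * tnth t l))).
Proof.
elim: T => [|m T IH].
  apply: (eq_integrable measurableT _ _ _ (gavg1 (0, 0, 0, 0) M).1) => t _ /=.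
  by rewrite ev_nil !mul0r.
apply: (eq_integrable measurableT _ _ _ (integrableD measurableT (gavg1 m M).1 IH)) => t _ /=.
by rewrite -EFinD /ev big_cons mulrDr.
Qed.

(** A term of frequency [(p, q)] integrates to a multiple of [exp (- k M^2)] with [k] proportional
    to [p^2 + q^2], because [i] and [l] are distinct; only the zero frequency survives. *)
Lemma cvg_gavg T : gavg T M @[M --> +oo] --> gaussZ q0 ^+ n * mean T.
Proof.
rewrite /gavg /mean; elim: T => [|m T IH].
  rewrite big_nil mulr0 (_ : (fun M => _) = fun=> 0); first exact: cvg_cst.
  apply/funext => M; under eq_Rintegral do rewrite ev_nil mulr0.
  by rewrite Rintegral_cst// mul0r.
rewrite big_cons mulrDr.
rewrite (_ : (fun M => _) = (fun M =>
   \int[leb]_t (tgauss q0 t * ev1 m (M * tnth t i) (M * tnth t l)) +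
   \int[leb]_t (tgauss q0 t * ev T (M * tnth t i) (M * tnth t l)))); last first.
  apply/funext => M; rewrite -RintegralD//.
  - by apply: eq_Rintegral => t _; rewrite /ev big_cons mulrDr.
  - exact: (gavg1 m M).1.
  - exact: integrable_gauss_ev.
apply: cvgD => //; case: m => [[[c p] q] a].
under eq_fun do rewrite (gavg1 _ _).2.
apply: cvgM; first exact: cvg_cst.
rewrite /=; case: ifPn => [/andP[/eqP-> /eqP->]|pq].
  rewrite (_ : (fun M => _) = fun=> c * cos a); first exact: cvg_cst.
  by apply/funext => M; rewrite expr0n/= addr0 mulr0 oppr0 mul0r expR0 mul1r.
rewrite -[X in _ --> X](mulr0 c); apply: cvgM; first exact: cvg_cst.
rewrite -[X in _ --> X](mul0r (cos a)); apply: cvgM; last exact: cvg_cst.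
have k0 : 0 < (p ^+ 2 + q ^+ 2) / (2 * q0).
  rewrite divr_gt0// ?mulr_gt0// lt_neqAle addr_ge0 ?sqr_ge0// andbT eq_sym.
  by rewrite paddr_eq0 ?sqr_ge0// !sqrf_eq0.
set k := (_ / _) in k0.
have e M : - (M ^+ 2 * (p ^+ 2 + q ^+ 2)) / (2 * q0) = - (k * M ^+ 2).
  by rewrite /k; ring.
under eq_fun do rewrite e.
apply/cvgrPdist_le => eps eps0; near=> M.
have M1 : 1 <= M by near: M; exact: nbhs_pinfty_ge.
rewrite sub0r normrN ger0_norm ?expR_ge0// expRN -[leRHS]invrK lef_pV2 ?posrE ?expR_gt0 ?invr_gt0//.
apply: le_trans (expR_ge1Dx _); rewrite -lerBlDl.
apply: (@le_trans _ _ (k * M)).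
  rewrite mulrC -ler_pdivrMr//; near: M; exact: nbhs_pinfty_ge.
by rewrite ler_pM2l// expr2 ler_peMl// (le_trans ler01).
Unshelve. all: by end_near. Qed.

(** Positivity is invisible on the coefficients; it is inherited from the Gaussian averages that
    converge to the mean. *)
Lemma mean_ge0_gauss T : (forall y z, 0 <= ev T y z) -> 0 <= mean T.
Proof.
move=> T0; have Z0 : 0 < gaussZ q0 ^+ n by rewrite exprn_gt0// gaussZ_gt0.
rewrite -(pmulr_rge0 _ Z0).
have h := @cvg_gavg T; rewrite -(cvg_lim (@Rhausdorff R) h).
apply: limr_ge; first exact: cvgP h.
by apply: nearW => M; apply: Rintegral_ge0 => t _; rewrite mulr_ge0 ?expR_ge0.
Qed.

End gauss_mean.

Lemma mean_ge0 T : (forall y z, 0 <= ev T y z) -> 0 <= mean T.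
Proof. exact: (@mean_ge0_gauss 2 ord0 (lift ord0 ord0) isT 1 ltr01). Qed.

Lemma le_mean A B : (forall y z, ev A y z <= ev B y z) -> mean A <= mean B.
Proof.
move=> AB; rewrite -subr_ge0 -mulN1r -meanZ -meanD; apply: mean_ge0 => y z.
by rewrite evD evZ mulN1r subr_ge0.
Qed.

(** Although [mean] reads a list of terms, it depends only on the function, so a list may be
    exchanged for any other with the same values. *)
Lemma eq_mean A B : (forall y z, ev A y z = ev B y z) -> mean A = mean B.
Proof. by move=> AB; apply/eqP; rewrite eq_le !le_mean// => y z; rewrite AB. Qed.

Lemma near_all (I : eqType) (r : seq I) (P : I -> R -> Prop) :
  (forall k, k \in r -> \forall M \near +oo, P k M) ->
  \forall M \near +oo, forall k, k \in r -> P k M.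
Proof.
elim: r => [|k r IH] h; first exact: nearW.
have h1 := h k (mem_head _ _).
have h2 : \forall M \near +oo, forall k, k \in r -> P k M.
  by apply: IH => j jr; apply: h; rewrite inE jr orbT.
near=> M => j; rewrite inE => /predU1P[->|]; first by near: M.
by move: j; near: M.
Unshelve. all: by end_near. Qed.

Lemma near_mul_neq x y : x != 0 -> \forall M \near +oo, M * x + y != 0 /\ M * x - y != 0.
Proof.
move=> x0; near=> M.
have h : `|y| < M * `|x|.
  by rewrite -ltr_pdivrMr ?normr_gt0//; near: M; exact: nbhs_pinfty_gt.
have M0 : 0 <= M by near: M; exact: nbhs_pinfty_ge.
have k : `|y| < `|M * x| by rewrite normrM (ger0_norm M0).
split; first by apply: contraTneq k => /eqP; rewrite addr_eq0 => /eqP ->; rewrite normrN ltxx.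
by apply: contraTneq k => /eqP; rewrite subr_eq0 => /eqP ->; rewrite ltxx.
Unshelve. all: by end_near. Qed.

(** Once [M] is large, a nonzero dilated frequency of [B] cannot be cancelled by one of the finitely
    many frequencies of [A]. Hence an equality, and not merely a limit. *)
Lemma mean_mul_dil A B : \forall M \near +oo, mean (mulT A (dilT M B)) = mean A * mean B.
Proof.
have h : \forall M \near +oo, forall m, m \in A -> forall m', m' \in B ->
    \sum_(k <- mul1 m (let: (c, p, q, a) := m' in (c, M * p, M * q, a))) mean1 k = mean1 m * mean1 m'.
  apply: near_all => m _; apply: near_all => m' _.
  case: m => [[[c p] q] a]; case: m' => [[[c' p'] q'] a'] /=.
  have [p0|p0] := eqVneq p' 0; first have [q00|q00] := eqVneq q' 0.
  - apply: nearW => M; rewrite big_cons big_seq1 /= p0 q00 !mulr0 !add0r !oppr_eq0.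
    case: ifP => _; rewrite ?mul0r ?addr0//.
    by rewrite cosD cosB; field.
  - near=> M.
    have [h1 h2] : M * q' + q != 0 /\ M * q' - q != 0 by near: M; exact: near_mul_neq.
    by rewrite big_cons big_seq1 /= (negbTE h1) (negbTE h2) !andbF mulr0 addr0.
  - near=> M.
    have [h1 h2] : M * p' + p != 0 /\ M * p' - p != 0 by near: M; exact: near_mul_neq.
    by rewrite big_cons big_seq1 /= (negbTE h1) (negbTE h2) /= mulr0 addr0.
near=> M; rewrite /mean big_mulT mulr_suml big_seq [RHS]big_seq; apply: eq_bigr => m mA.
rewrite big_map mulr_sumr big_seq [RHS]big_seq; apply: eq_bigr => m' mB.
by move: m mA m' mB; near: M.
Unshelve. all: by end_near. Qed.

End trig_lists.

(** * Half-planes of frequencies and conjugation of products *)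

Section tree.
Context {R : realType}.
Local Notation trig := (@trig R).
Local Notation term := (@term R).
Implicit Types (c p q a s t u v x y z M : R) (A B T f : trig) (m : term).

Definition freq s (m : term) := let: (c, p, q, a) := m in p * s + q.
Definition sgn_in (e : pred R) s T := all (fun m => e (Num.sg (freq s m))) T.
Definition nz s T := sgn_in (fun x => x != 0) s T.

Lemma near_sg u v : v != 0 -> \forall M \near +oo,
  Num.sg (M * v + u) = Num.sg v /\ Num.sg (M * v - u) = Num.sg v.
Proof.
move=> v0; near=> M.
have h : `|u| < M * `|v|.
  by rewrite -ltr_pdivrMr ?normr_gt0//; near: M; exact: nbhs_pinfty_gt.
have [h1 h2] := (ler_norm u, ler_norm (- u)); rewrite normrN in h2.
have [vn|vp|v00] := ltgtP v 0; last by rewrite v00 eqxx in v0.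
  by rewrite (ltr0_norm vn) in h; rewrite !ltr0_sg//; lra.
by rewrite (gtr0_norm vp) in h; rewrite !gtr0_sg//; lra.
Unshelve. all: by end_near. Qed.

(** The frequency of [B] is scaled by [M] and, lying off the boundary line by [nz], outweighs that
    of [A]. *)
Lemma near_sg_mul s A B : nz s B -> \forall M \near +oo,
  forall m, m \in A -> forall m', m' \in B ->
  forall k, k \in mul1 m (let: (c, p, q, a) := m' in (c, M * p, M * q, a)) ->
  Num.sg (freq s k) = Num.sg (freq s m').
Proof.
move=> /allP nzB; apply: near_all => m _; apply: near_all => m' /nzB.
rewrite sgr_eq0; case: m => [[[c p] q] a]; case: m' => [[[c' p'] q'] a'] /= v0.
near=> M => k.
have [h1 h2] : Num.sg (M * (p' * s + q') + (p * s + q)) = Num.sg (p' * s + q') /\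
    Num.sg (M * (p' * s + q') - (p * s + q)) = Num.sg (p' * s + q').
  by near: M; exact: near_sg.
rewrite !inE => /orP[/eqP->|/eqP->] /=; [rewrite -h1|rewrite -h2];
  by congr Num.sg; ring.
Unshelve. all: by end_near. Qed.

Lemma near_sgn_in_mul (e : pred R) s A B : nz s B -> sgn_in e s B ->
  \forall M \near +oo, sgn_in e s (mulT A (dilT M B)).
Proof.
move=> nzB /allP eB; have := near_sg_mul A nzB; apply: filterS => M h.
apply/allP => k /flattenP[_ /mapP[m mA ->]] /flattenP[_ /mapP[m'' /mapP[m' mB ->] ->] kk].
by rewrite (h _ mA _ mB _ kk); exact: eB.
Qed.

(** A Bedrosian identity: a low-frequency factor passes through the conjugation of a high-frequency
    one. *)
Lemma near_conj_mul s A B : nz s B -> \forall M \near +oo, forall y z,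
  ev (conjT s (mulT A (dilT M B))) y z = ev A y z * ev (conjT s B) (M * y) (M * z).
Proof.
move=> nzB; have := near_sg_mul A nzB; apply: filterS => M h y z.
rewrite /ev big_map big_mulT mulr_suml big_seq [RHS]big_seq; apply: eq_bigr => m mA.
rewrite !big_map mulr_sumr big_seq [RHS]big_seq; apply: eq_bigr => m' mB.
have := h m mA m' mB; case: m mA => [[[c p] q] a] _; case: m' mB => [[[c' p'] q'] a'] _ /= hs.
have h1 := hs _ (mem_head _ _); have h2 := hs _ (mem_last _ _); rewrite /= in h1 h2.
rewrite big_cons big_seq1 /= h1 h2.
set U := p' * (M * y) + q' * (M * z) + a'; set V := p * y + q * z + a.
have -> : (M * p' + p) * y + (M * q' + q) * z + (a' + a - pi / 2) = U + V - pi / 2 by rewrite /U /V; ring.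
have -> : (M * p' - p) * y + (M * q' - q) * z + (a' - a - pi / 2) = U - V - pi / 2 by rewrite /U /V; ring.
have -> : p' * (M * y) + q' * (M * z) + (a' - pi / 2) = U - pi / 2 by rewrite /U; ring.
by rewrite !cosBpihalf sinD sinB; field.
Qed.

Lemma conjT_pos s T y z : sgn_in (pred1 1) s T -> ev (conjT s T) y z = ev (hatT T) y z.
Proof.
move=> /allP h; rewrite /ev !big_map big_seq [RHS]big_seq; apply: eq_bigr => m /h.
by case: m => [[[c p] q] a] /= /eqP ->; rewrite mul1r.
Qed.

Lemma conjT_neg s T y z : sgn_in (pred1 (-1)) s T -> ev (conjT s T) y z = - ev (hatT T) y z.
Proof.
move=> /allP h; rewrite /ev !big_map -sumrN big_seq [RHS]big_seq; apply: eq_bigr => m /h.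
by case: m => [[[c p] q] a] /= /eqP ->; rewrite mulN1r mulNr.
Qed.

Lemma nz_mean s T : nz s T -> mean T = 0 /\ mean (hatT T) = 0.
Proof.
move=> /allP h; rewrite /mean big_map.
by split; rewrite big_seq big1// => m /h; rewrite sgr_eq0; case: m => [[[c p] q] a] /=;
  case: ifP => // /andP[/eqP-> /eqP->]; rewrite mul0r addr0 eqxx.
Qed.

Lemma ev_flatten (I : Type) (r : seq I) (F : I -> trig) y z :
  ev (flatten [seq F k | k <- r]) y z = \sum_(k <- r) ev (F k) y z.
Proof. by rewrite /ev big_flatten big_map. Qed.

(** * Polynomials in one angle, and the approximation of the sign of its sine *)

Section one_frequency.
Variable t : R.

(** At the frequency [(1, - t)] the quantity [p s + q] is [s - t], so its sign tells on which side
    of [t] the ratio [s] lies. *)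
Definition cosT : trig := [:: (1, 1, - t, 0)].
Definition sinT : trig := [:: (1, 1, - t, - (pi / 2))].

Lemma ev_cosT y z : ev cosT y z = cos (y - t * z).
Proof. by rewrite /ev big_seq1 /= !mul1r addr0 mulNr. Qed.

Lemma ev_sinT y z : ev sinT y z = sin (y - t * z).
Proof. by rewrite /ev big_seq1 /= !mul1r mulNr cosBpihalf. Qed.

Fixpoint cosP k : trig := if k is k'.+1 then mulT cosT (cosP k') else constT 1.

Lemma ev_cosP k y z : ev (cosP k) y z = cos (y - t * z) ^+ k.
Proof. by elim: k => [|k IH]; rewrite ?ev_const ?expr0//= evM ev_cosT IH exprS. Qed.

Lemma ev_der_cosT y z : ev (derT cosT) y z = - sin (y - t * z).
Proof. by rewrite /ev big_seq1 /= !mul1r add0r mulNr cosDpihalf'. Qed.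

Lemma ev_der_sinT y z : ev (derT sinT) y z = cos (y - t * z).
Proof. by rewrite /ev big_seq1 /= !mul1r addNr addr0 mulNr. Qed.

(** Multiplying by the cosine avoids the exponent [k - 1], and with it a special case at [k = 0]. *)
Lemma ev_der_cosP k y z :
  ev (derT (cosP k)) y z * cos (y - t * z) = - k%:R * sin (y - t * z) * cos (y - t * z) ^+ k.
Proof.
elim: k => [|k IH]; first by rewrite /ev big_seq1 /= !mul0r oppr0 !mul0r.
rewrite /= ev_der_mul mulrDl -[X in _ + X]mulrA IH ev_der_cosT ev_cosT ev_cosP -natr1 exprS; ring.
Qed.

(** The Wallis recurrence: the derivative of [sin cos^(n+1)] has mean zero. *)
Lemma mean_cosP_rec n :
  (n%:R + 2) * mean (cosP n.+2) = (n%:R + 1) * mean (cosP n).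
Proof.
have h := mean_der (mulT sinT (cosP n.+1)).
have e : mean (derT (mulT sinT (cosP n.+1))) =
  mean (scaleT (n%:R + 2) (cosP n.+2) ++ scaleT (- (n%:R + 1)) (cosP n)).
  apply: eq_mean => y z; rewrite ev_der_mul [RHS]evD !evZ ev_der_sinT ev_sinT.
  rewrite [in derT _]/cosP -/cosP ev_der_mul ev_der_cosT ev_cosT !ev_cosP.
  have := ev_der_cosP n y z.
  set C := cos _; set S := sin _; set D := ev _ _ _ => hD; rewrite !exprS.
  set Cn := C ^+ n in hD *.
  have cs : S ^+ 2 = 1 - C ^+ 2 by rewrite -[X in X - _](cos2Dsin2 (y - t * z)) addrC addKr.
  transitivity (C ^+ 2 * Cn - S ^+ 2 * Cn + S * (D * C)); first by ring.
  rewrite hD; transitivity (C ^+ 2 * Cn - (1 + n%:R) * S ^+ 2 * Cn); first by ring.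
  by rewrite cs; ring.
by rewrite h meanD !meanZ in e; lra.
Qed.

Lemma mean_cosP0 : mean (cosP 0) = 1. Proof. exact: mean_const. Qed.

Lemma mean_cosP_ge0 k : 0 <= mean (cosP (2 * k)).
Proof. by apply: mean_ge0 => y z; rewrite ev_cosP exprM exprn_ge0 ?sqr_ge0. Qed.

(** These Wallis means decay like [k^(-1/2)]. By the recurrence, the induction step comes down to
    [(2k + 1)(2k + 3) <= (2k + 2)^2]. *)
Lemma mean_cosP_le k : mean (cosP (2 * k)) ^+ 2 * (2 * k%:R + 1) <= 1.
Proof.
elim: k => [|k IH]; first by rewrite muln0 mean_cosP0 mulr0 add0r expr1n mulr1.
have r := mean_cosP_rec (2 * k); have k0 : 0 <= k%:R :> R by rewrite ler0n.
have -> : (2 * k.+1 = (2 * k).+2)%N by rewrite mulnS.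
rewrite natrM in r.
set c := mean (cosP (2 * k)) in IH r; set c' := mean _ in r *.
have -> : k.+1%:R = k%:R + 1 :> R by rewrite natr1.
set x : R := k%:R in k0 IH r *.
have h0 : 0 < (2 * x + 2) ^+ 2 by rewrite exprn_gt0//; lra.
rewrite -(ler_pM2l h0) mulr1 mulrA -exprMn r.
have e : ((2 * x + 1) * c) ^+ 2 * (2 * (x + 1) + 1) =
  (c ^+ 2 * (2 * x + 1)) * ((2 * x + 1) * (2 * x + 3)) by ring.
rewrite e; apply: (@le_trans _ _ (1 * ((2 * x + 1) * (2 * x + 3)))).
  by apply: ler_wpM2r => //; apply: mulr_ge0; lra.
by rewrite mul1r; nra.
Qed.

(** Newton-Schulz iteration for the sign, [x -> x (3 - x^2) / 2], started at the sine: polynomial at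
    each stage, with superattracting fixed points 1 and -1. *)
Fixpoint psi k : trig := if k is k'.+1
  then scaleT (3 / 2) (psi k') ++ scaleT (- (1 / 2)) (mulT (psi k') (mulT (psi k') (psi k')))
  else sinT.

Lemma ev_psiS k y z : ev (psi k.+1) y z = ev (psi k) y z * (3 - ev (psi k) y z ^+ 2) / 2.
Proof. by rewrite /= evD !evZ !evM; field. Qed.

(** If [x'] is the next iterate then [1 - x'^2 = (1 - x^2)^2 (4 - x^2) / 4], so the defect is at
    least squared at each step, starting from [cos^2]. The factor [(3 - x^2) / 2] is at least 1,
    which preserves the last inequality. *)
Lemma psi_props k y z : [/\ ev (psi k) y z ^+ 2 <= 1,
  1 - ev (psi k) y z ^+ 2 <= (cos (y - t * z) ^+ 2) ^+ (2 ^ k) &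
  sin (y - t * z) ^+ 2 <= ev (psi k) y z * sin (y - t * z)].
Proof.
have cs := cos2Dsin2 (y - t * z).
elim: k => [|k [IH1 IH2 IH3]].
  rewrite ev_sinT; split; [|by rewrite expr1; lra|by rewrite expr2].
  have := sqr_ge0 (cos (y - t * z)); lra.
rewrite ev_psiS; set x := ev (psi k) y z in IH1 IH2 IH3 *; set S := sin _ in IH3 *.
have x20 := sqr_ge0 x.
have e : 1 - (x * (3 - x ^+ 2) / 2) ^+ 2 = (1 - x ^+ 2) ^+ 2 * ((4 - x ^+ 2) / 4) by field.
have s0 := sqr_ge0 (1 - x ^+ 2).
split.
- rewrite -subr_ge0 e mulr_ge0//; lra.
- rewrite e expnS mulnC exprM; apply: (@le_trans _ _ ((1 - x ^+ 2) ^+ 2)).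
    by rewrite ler_piMr//; lra.
  have a0 : 0 <= 1 - x ^+ 2 by lra.
  have b0 : 0 <= (cos (y - t * z) ^+ 2) ^+ (2 ^ k) by rewrite exprn_ge0 ?sqr_ge0.
  by rewrite ler_sqr ?nnegrE.
- have S0 := sqr_ge0 S.
  have -> : x * (3 - x ^+ 2) / 2 * S = (x * S) * ((3 - x ^+ 2) / 2) by ring.
  have xS : 0 <= x * S := le_trans S0 IH3.
  have h3 : 1 <= (3 - x ^+ 2) / 2 by lra.
  exact: le_trans IH3 (ler_peMr xS h3).
Qed.

(** With [phic], a nonnegative partition of unity close to the indicators of positive and negative
    sine; the difference of the two is [psi k]. *)
Definition phi k : trig := scaleT (1 / 2) (constT 1 ++ psi k).
Definition phic k : trig := scaleT (1 / 2) (constT 1 ++ scaleT (- 1) (psi k)).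

Lemma ev_phi k y z : ev (phi k) y z = (1 + ev (psi k) y z) / 2.
Proof. by rewrite evZ evD ev_const; ring. Qed.

Lemma ev_phic k y z : ev (phic k) y z = (1 - ev (psi k) y z) / 2.
Proof. by rewrite evZ evD ev_const evZ; ring. Qed.

Lemma phi_ge0 k y z : 0 <= ev (phi k) y z.
Proof.
rewrite ev_phi divr_ge0//; have [h _ _] := psi_props k y z.
have : `|ev (psi k) y z| <= 1 by rewrite -(@expr_le1 _ 2)// real_normK ?num_real.
by rewrite ler_norml => /andP[? _]; lra.
Qed.

Lemma phic_ge0 k y z : 0 <= ev (phic k) y z.
Proof.
rewrite ev_phic divr_ge0//; have [h _ _] := psi_props k y z.
have : `|ev (psi k) y z| <= 1 by rewrite -(@expr_le1 _ 2)// real_normK ?num_real.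
by rewrite ler_norml => /andP[_ ?]; lra.
Qed.

(** The first bound is the gain [1 / 2] of a level, the mean of [sin^2]. The second keeps the loss
    on the inherited [m / 4] at most [1 / 4], because [phi^2 + phic^2 = 1 - (1 - psi^2) / 2]. *)
Lemma mean_phi_sq (m : nat) : exists k : nat,
  [/\ mean (mulT (psi k) sinT) >= 1 / 2 &
   m%:R * (mean (mulT (phi k) (phi k)) + mean (mulT (phic k) (phic k))) >= m%:R - 1].
Proof.
(* As [m^2 <= 2^(m^2)], the Wallis bound makes [m] times the mean of the [2^(k+1)]-th power of the
   cosine at most 1. *)
exists (m * m)%N; set k := (m * m)%N.
have c1 : mean (cosP 2) = 1 / 2.
  by have := mean_cosP_rec 0; rewrite !add0r mean_cosP0 => h; lra.
split.
  apply: (@le_trans _ _ (mean (constT 1 ++ scaleT (-1) (cosP 2)))).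
    by rewrite meanD meanZ mean_const c1; lra.
  apply: le_mean => y z; rewrite evD ev_const evZ ev_cosP evM ev_sinT.
  have [_ _] := psi_props k y z; have := cos2Dsin2 (y - t * z) => ? ?; lra.
set K := (2 ^ k)%N; set c := mean (cosP (2 * K)).
have h : 1 - c / 2 <= mean (mulT (phi k) (phi k)) + mean (mulT (phic k) (phic k)).
  rewrite -meanD; apply: (@le_trans _ _ (mean (constT 1 ++ scaleT (- (1 / 2)) (cosP (2 * K))))).
    by rewrite meanD meanZ mean_const -/c; lra.
  apply: le_mean => y z; rewrite [leLHS]evD [leRHS]evD !evM ev_const evZ ev_cosP ev_phi ev_phic exprM.
  have [_ h _] := psi_props k y z; rewrite -/K in h.
  set x := ev _ _ _ in h *.
  have -> : (1 + x) / 2 * ((1 + x) / 2) + (1 - x) / 2 * ((1 - x) / 2) = 1 - (1 - x ^+ 2) / 2 by field.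
  lra.
apply: le_trans (ler_wpM2l (ler0n _ _) h).
have c0 : 0 <= c by exact: mean_cosP_ge0.
have c2 : c ^+ 2 * (2 * K%:R + 1) <= 1 by exact: mean_cosP_le.
have mK : m%:R ^+ 2 <= K%:R :> R.
  by rewrite -natrX ler_nat -mulnn ltnW// ltn_expl.
have m0 : 0 <= m%:R :> R by rewrite ler0n.
suff : m%:R * c <= 1 by lra.
rewrite -(@expr_le1 _ 2)// ?mulr_ge0// exprMn.
have m2 := sqr_ge0 (m%:R : R).
apply: le_trans c2; rewrite mulrC; apply: ler_wpM2l; [exact: sqr_ge0|lra].
Qed.

End one_frequency.

End tree.

(** * Unboundedness of the maximal conjugation, by induction on the depth *)

Section tree_induction.
Context {R : realType}.
Local Notation trig := (@trig R).
Local Notation term := (@term R).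
Implicit Types (c p q a s t u v x y z M : R) (A B T f : trig) (S sigma : seq R).

(** A threshold outside the list of ratios keeps the frequency of [cosT] off every boundary line. *)
Lemma exists_between_notin S x y : x < y -> exists t, [/\ x < t, t < y & t \notin S].
Proof.
elim: S x y => [|s S IH] x y xy.
  by exists ((x + y) / 2); split=> //; lra.
have [xs|sx] := ltP x s; first have [sy|ys] := ltP s y.
- have [t [xt ts tS]] := IH _ _ xs; exists t; split; rewrite ?(lt_trans ts)//.
  by rewrite inE negb_or tS andbT lt_eqF.
- have [t [xt ty tS]] := IH _ _ xy; exists t; split => //.
  by rewrite inE negb_or tS andbT lt_eqF// (lt_le_trans ty).
- have [t [xt ty tS]] := IH _ _ xy; exists t; split => //.
  by rewrite inE negb_or tS andbT gt_eqF// (le_lt_trans sx).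
Qed.

Lemma conjT_cat s A B : conjT s (A ++ B) = conjT s A ++ conjT s B.
Proof. exact: map_cat. Qed.

Lemma sgn_in_cat (e : pred R) s A B : sgn_in e s (A ++ B) = sgn_in e s A && sgn_in e s B.
Proof. exact: all_cat. Qed.

(** The linearised maximal conjugate: with nonnegative weights of sum 1, it lies pointwise below the
    largest conjugate. *)
Definition target sigma f (g : R -> trig) : trig :=
  flatten [seq mulT (g s) (conjT s f) | s <- sigma].

(** The list [S] of all ratios stays fixed while [sigma] is the part treated by a subtree. The sign
    conditions concern ratios of [S] beyond all of [sigma]: for these the conjugate of [f] is
    [hatT f] or its opposite, so a subtree acts on the other half in a known way. *)
Record tree_fun (m : nat) S sigma f (g : R -> trig) : Prop := TreeFun {
  tree_nz : forall s, s \in S -> nz s f ;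
  tree_pos : forall s, s \in S -> (forall r, r \in sigma -> r < s) -> sgn_in (pred1 1) s f ;
  tree_neg : forall s, s \in S -> (forall r, r \in sigma -> s < r) -> sgn_in (pred1 (-1)) s f ;
  tree_le : forall y z, `|ev f y z| <= m%:R ;
  tree_sq : mean (mulT f f) <= m%:R / 2 ;
  tree_g0 : forall s y z, 0 <= ev (g s) y z ;
  tree_g1 : forall y z, \sum_(s <- sigma) ev (g s) y z = 1 ;
  tree_conj : m%:R / 4 <= mean (target sigma f g) }.

Section step.
Variables (m : nat) (S L Rr : seq R) (fL fR : trig) (gL gR : R -> trig) (t : R).
Hypotheses (tL : forall s, s \in L -> s < t) (tR : forall s, s \in Rr -> t < s).
Hypotheses (tS : t \notin S) (LS : {subset L <= S}) (RS : {subset Rr <= S}).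
Hypotheses (L0 : exists s, s \in L) (R0 : exists s, s \in Rr).
Hypotheses (HL : tree_fun m S L fL gL) (HR : tree_fun m S Rr fR gR).

(** On the ratios of [L] the conjugate of [fR] is [- hatT fR], and on those of [Rr] that of [fL] is
    [hatT fL]. These cross terms do not depend on [s], so the weights sum out; after dilation their
    means factor and vanish. What remains is the gain and the two inherited targets with factors
    [pc^2] and [ph^2]. *)
Lemma tree_step : exists f g, tree_fun m.+1 S (L ++ Rr) f g.
Proof.
have [k [kS kphi]] := mean_phi_sq t m.
pose ph := phi t k; pose pc := phic t k.
have phE y z : ev ph y z = (1 + ev (psi t k) y z) / 2 by exact: ev_phi.
have pcE y z : ev pc y z = (1 - ev (psi t k) y z) / 2 by exact: ev_phic.
have ph0 y z : 0 <= ev ph y z by exact: phi_ge0.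
have pc0 y z : 0 <= ev pc y z by exact: phic_ge0.
have ph1 y z : ev ph y z + ev pc y z = 1 by rewrite phE pcE; field.
have mph : mean ph + mean pc = 1.
  rewrite -meanD -[RHS](mean_const 1); apply: eq_mean => y z.
  by rewrite [LHS]evD ev_const ph1.
have mph0 : 0 <= mean ph by exact: mean_ge0.
have mpc0 : 0 <= mean pc by exact: mean_ge0.
rewrite -/ph -/pc in kphi; clearbody ph pc.
move: (psi t k) => ps in kS phE pcE *.
pose AR := target Rr fR gR; pose AL := target L fL gL.
pose F M := cosT t ++ (mulT ph (dilT M fR) ++ mulT pc (dilT M fL)).
pose g M s := if t < s then mulT ph (dilT M (gR s)) else mulT pc (dilT M (gL s)).
have FE M y z : ev (F M) y z = cos (y - t * z) +
    (ev ph y z * ev fR (M * y) (M * z) + ev pc y z * ev fL (M * y) (M * z)).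
  by rewrite /F evD ev_cosT evD !evM !ev_dil.
have dec A B : \forall M \near +oo, mean (mulT A (dilT M B)) = mean A * mean B.
  exact: mean_mul_dil.
have nS : forall (P : R -> R -> Prop), (forall s, s \in S -> \forall M \near +oo, P s M) ->
    \forall M \near +oo, forall s, s \in S -> P s M by move=> P; exact: near_all.
have sgnF e : \forall M \near +oo, forall s, s \in S ->
   (sgn_in (pred1 e) s fR -> sgn_in (pred1 e) s (mulT ph (dilT M fR))) /\
   (sgn_in (pred1 e) s fL -> sgn_in (pred1 e) s (mulT pc (dilT M fL))).
  apply: nS => s sS.
  have hR : \forall M \near +oo, sgn_in (pred1 e) s fR -> sgn_in (pred1 e) s (mulT ph (dilT M fR)).
    have [h|h] := boolP (sgn_in (pred1 e) s fR); last exact: nearW.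
    have := near_sgn_in_mul ph (tree_nz HR sS) h; exact: filterS.
  have hL : \forall M \near +oo, sgn_in (pred1 e) s fL -> sgn_in (pred1 e) s (mulT pc (dilT M fL)).
    have [h|h] := boolP (sgn_in (pred1 e) s fL); last exact: nearW.
    have := near_sgn_in_mul pc (tree_nz HL sS) h; exact: filterS.
  by near=> M; split; near: M.
have nzN : \forall M \near +oo, forall s, s \in S ->
    nz s (mulT ph (dilT M fR)) /\ nz s (mulT pc (dilT M fL)).
  apply: nS => s sS.
  have hR := near_sgn_in_mul ph (tree_nz HR sS) (tree_nz HR sS).
  have hL := near_sgn_in_mul pc (tree_nz HL sS) (tree_nz HL sS).
  by near=> M; split; near: M.
have mS : m.+1%:R = m%:R + 1 :> R by rewrite natr1.
(* A single [M] serves all the sign conditions and mean identities, each of which holds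
   eventually. *)
near (pinfty_nbhs R) => M.
have cs y z := cos2Dsin2 (y - t * z).
exists (F M), (g M).
have cosT_freq s : sgn_in (fun x => x == Num.sg (s - t)) s (cosT t).
  by rewrite /sgn_in /= andbT mul1r eqxx.
have [sR0 sR0R] := R0; have [sL0 sL0L] := L0.
have conjR s : s \in S -> forall y z, ev (conjT s (mulT ph (dilT M fR))) y z =
    ev ph y z * ev (conjT s fR) (M * y) (M * z).
  by move: s; near: M; apply: nS => s sS; apply: near_conj_mul; exact: (tree_nz HR).
have conjL s : s \in S -> forall y z, ev (conjT s (mulT pc (dilT M fL))) y z =
    ev pc y z * ev (conjT s fL) (M * y) (M * z).
  by move: s; near: M; apply: nS => s sS; apply: near_conj_mul; exact: (tree_nz HL).
have conjF s y z : s \in S -> ev (conjT s (F M)) y z = Num.sg (s - t) * sin (y - t * z) +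
   (ev ph y z * ev (conjT s fR) (M * y) (M * z) + ev pc y z * ev (conjT s fL) (M * y) (M * z)).
  move=> sS.
  have -> : ev (conjT s (F M)) y z = ev (conjT s (cosT t)) y z +
      (ev (conjT s (mulT ph (dilT M fR))) y z + ev (conjT s (mulT pc (dilT M fL))) y z).
    by rewrite -!evD -!conjT_cat.
  rewrite conjR// conjL//.
  congr (_ + _); rewrite /ev big_seq1 /= !mul1r mulr1 add0r mulNr.
  by rewrite cosBpihalf.
have nzF : forall s, s \in S ->
    nz s (mulT ph (dilT M fR)) /\ nz s (mulT pc (dilT M fL)).
  by near: M.
have signp : forall s, s \in S ->
   (sgn_in (pred1 1) s fR -> sgn_in (pred1 1) s (mulT ph (dilT M fR))) /\
   (sgn_in (pred1 1) s fL -> sgn_in (pred1 1) s (mulT pc (dilT M fL))).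
  by near: M; exact: sgnF.
have signn : forall s, s \in S ->
   (sgn_in (pred1 (-1)) s fR -> sgn_in (pred1 (-1)) s (mulT ph (dilT M fR))) /\
   (sgn_in (pred1 (-1)) s fL -> sgn_in (pred1 (-1)) s (mulT pc (dilT M fL))).
  by near: M; exact: sgnF.
split.
- move=> s sS; rewrite /nz /F !sgn_in_cat.
  have [] := nzF s sS; rewrite /nz => -> ->; rewrite !andbT /= andbT mul1r sgr_eq0 subr_eq0.
  by apply: contraNneq tS => <-.
- move=> s sS sp; rewrite /F !sgn_in_cat.
  have [h1 h2] := signp s sS.
  rewrite h1 ?h2; last 2 first.
  + by apply: (tree_pos HL) => // r rL; apply: sp; rewrite mem_cat rL.
  + by apply: (tree_pos HR) => // r rR; apply: sp; rewrite mem_cat rR orbT.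
  rewrite !andbT /= andbT mul1r gtr0_sg ?eqxx// subr_gt0.
  by apply: lt_trans (tR sR0R) (sp _ _); rewrite mem_cat sR0R orbT.
- move=> s sS sp; rewrite /F !sgn_in_cat.
  have [h1 h2] := signn s sS.
  rewrite h1 ?h2; last 2 first.
  + by apply: (tree_neg HL) => // r rL; apply: sp; rewrite mem_cat rL.
  + by apply: (tree_neg HR) => // r rR; apply: sp; rewrite mem_cat rR orbT.
  rewrite !andbT /= andbT mul1r ltr0_sg ?eqxx// subr_lt0.
  by apply: lt_trans (sp _ _) (tL sL0L); rewrite mem_cat sL0L.
- move=> y z; rewrite FE mS [leRHS]addrC; apply: le_trans (ler_normD _ _) _.
  apply: lerD; first exact: norm_cos_le1.
  apply: le_trans (ler_normD _ _) _; rewrite -[leRHS]mul1r -[X in _ <= X * _](ph1 y z) mulrDl !normrM.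
  rewrite (ger0_norm (ph0 _ _)) (ger0_norm (pc0 _ _)).
  by apply: lerD; apply: ler_wpM2l => //; [exact: (tree_le HR)|exact: (tree_le HL)].
- have [cc ccE c2] : exists2 cc, (forall y z, ev cc y z = cos (y - t * z) ^+ 2) & mean cc = 1 / 2.
    exists (cosP t 2) => [y z|]; first by rewrite ev_cosP.
    by have := mean_cosP_rec t 0; rewrite mean_cosP0 !add0r mulr1 => h; lra.
  (* A majorant of the square: by convexity [(ph r + pc l)^2 <= ph r^2 + pc l^2], the difference
     being [ph pc (r - l)^2]. The cross terms with the cosine have mean zero, leaving
     [1 / 2 + m / 2]. *)
  pose W := cc ++ (scaleT 2 (mulT (mulT (cosT t) ph) (dilT M fR)) ++
    (scaleT 2 (mulT (mulT (cosT t) pc) (dilT M fL)) ++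
    (mulT ph (dilT M (mulT fR fR)) ++ mulT pc (dilT M (mulT fL fL))))).
  apply: (@le_trans _ _ (mean W)).
    apply: le_mean => y z; rewrite /W !evM FE !evD !evZ !evM !ev_dil !evM ev_cosT ccE.
    set C := cos _; set r := ev fR _ _; set l := ev fL _ _.
    have h := ph1 y z; set a := ev ph y z in h *.
    have a0 : 0 <= a := ph0 y z; have b0 := pc0 y z.
    have bE : ev pc y z = 1 - a by lra.
    rewrite bE in b0 *.
    have h2 : 0 <= a * (1 - a) * (r - l) ^+ 2 by apply: mulr_ge0; [exact: mulr_ge0|exact: sqr_ge0].
    rewrite -subr_ge0; apply: le_trans h2 _; rewrite le_eqVlt; apply/orP; left; apply/eqP; ring.
  have d1 : mean (mulT (mulT (cosT t) ph) (dilT M fR)) = mean (mulT (cosT t) ph) * mean fR.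
    by near: M; exact: dec.
  have d2 : mean (mulT (mulT (cosT t) pc) (dilT M fL)) = mean (mulT (cosT t) pc) * mean fL.
    by near: M; exact: dec.
  have d3 : mean (mulT ph (dilT M (mulT fR fR))) = mean ph * mean (mulT fR fR).
    by near: M; exact: dec.
  have d4 : mean (mulT pc (dilT M (mulT fL fL))) = mean pc * mean (mulT fL fL).
    by near: M; exact: dec.
  have [mR _] := nz_mean (tree_nz HR (RS sR0R)); have [mL _] := nz_mean (tree_nz HL (LS sL0L)).
  rewrite /W !meanD !meanZ d1 d2 d3 d4 mR mL !mulr0 !add0r c2 mS.
  have h1 := ler_wpM2l mph0 (tree_sq HR); have h2 := ler_wpM2l mpc0 (tree_sq HL).
  have e : mean ph * (m%:R / 2) + mean pc * (m%:R / 2) = m%:R / 2.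
    by rewrite -mulrDl mph mul1r.
  lra.
- move=> s y z; rewrite /g; case: ifP => _; rewrite evM ev_dil mulr_ge0//.
    exact: (tree_g0 HR).
  exact: (tree_g0 HL).
- move=> y z; rewrite big_cat /=.
  have -> : \sum_(s <- L) ev (g M s) y z = ev pc y z * \sum_(s <- L) ev (gL s) (M * y) (M * z).
    rewrite mulr_sumr big_seq [RHS]big_seq; apply: eq_bigr => s sL.
    by rewrite /g ltNge (ltW (tL sL)) /= evM ev_dil.
  have -> : \sum_(s <- Rr) ev (g M s) y z = ev ph y z * \sum_(s <- Rr) ev (gR s) (M * y) (M * z).
    rewrite mulr_sumr big_seq [RHS]big_seq; apply: eq_bigr => s sR.
    by rewrite /g tR// evM ev_dil.
  by rewrite (tree_g1 HL) (tree_g1 HR) !mulr1 addrC ph1.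
(* The selected sines add up to [(ph - pc) sin = ps sin], whose mean is at least [1 / 2]; with
   [(m - 1) / 4] from the squares this makes [(m + 1) / 4]. *)
- pose W := mulT ps (sinT t) ++ (mulT (mulT ph ph) (dilT M AR) ++
    (mulT (mulT ph pc) (dilT M (hatT fL)) ++
    (scaleT (-1) (mulT (mulT ph pc) (dilT M (hatT fR))) ++ mulT (mulT pc pc) (dilT M AL)))).
  have -> : mean (target (L ++ Rr) (F M) (g M)) = mean W.
    apply: eq_mean => y z; rewrite /target ev_flatten.
    have -> : \sum_(s <- L ++ Rr) ev (mulT (g M s) (conjT s (F M))) y z =
      \sum_(s <- L) ev (mulT (g M s) (conjT s (F M))) y z +
      \sum_(s <- Rr) ev (mulT (g M s) (conjT s (F M))) y z by rewrite big_cat.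
    have -> : \sum_(s <- L) ev (mulT (g M s) (conjT s (F M))) y z =
      ev pc y z * (- sin (y - t * z) - ev ph y z * ev (hatT fR) (M * y) (M * z)) +
      ev pc y z * ev pc y z * ev AL (M * y) (M * z).
      transitivity (\sum_(s <- L) ev (gL s) (M * y) (M * z) * (ev pc y z * (- sin (y - t * z) - ev ph y z * ev (hatT fR) (M * y) (M * z))) +
         \sum_(s <- L) ev pc y z * ev pc y z * ev (mulT (gL s) (conjT s fL)) (M * y) (M * z)); last first.
        by rewrite -mulr_suml (tree_g1 HL) mul1r -mulr_sumr /AL /target ev_flatten.
      rewrite -big_split big_seq [RHS]big_seq; apply: eq_bigr => s sL.
      rewrite [RHS]/=.
      rewrite evM conjF ?LS// /g ltNge (ltW (tL sL)) [~~ true]/= !evM ev_dil.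
      rewrite (conjT_neg (T := fR)); last first.
        by apply: (tree_neg HR); [exact: LS|move=> r rR; exact: lt_trans (tL sL) (tR rR)].
      rewrite (_ : Num.sg (s - t) = -1); last by rewrite ltr0_sg// subr_lt0 tL.
      by ring.
    have -> : \sum_(s <- Rr) ev (mulT (g M s) (conjT s (F M))) y z =
      ev ph y z * (sin (y - t * z) + ev pc y z * ev (hatT fL) (M * y) (M * z)) +
      ev ph y z * ev ph y z * ev AR (M * y) (M * z).
      transitivity (\sum_(s <- Rr) ev (gR s) (M * y) (M * z) * (ev ph y z * (sin (y - t * z) + ev pc y z * ev (hatT fL) (M * y) (M * z))) +
         \sum_(s <- Rr) ev ph y z * ev ph y z * ev (mulT (gR s) (conjT s fR)) (M * y) (M * z)); last first.
        by rewrite -mulr_suml (tree_g1 HR) mul1r -mulr_sumr /AR /target ev_flatten.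
      rewrite -big_split big_seq [RHS]big_seq; apply: eq_bigr => s sR.
      rewrite [RHS]/=.
      rewrite evM conjF ?RS// /g tR// !evM ev_dil.
      rewrite (conjT_pos (T := fL)); last first.
        by apply: (tree_pos HL); [exact: RS|move=> r rL; exact: lt_trans (tL rL) (tR sR)].
      rewrite (_ : Num.sg (s - t) = 1); last by rewrite gtr0_sg// subr_gt0 tR.
      by ring.
    by rewrite /W !evD evZ !evM !ev_dil ev_sinT phE pcE; field.
  have d1 : mean (mulT (mulT ph ph) (dilT M AR)) = mean (mulT ph ph) * mean AR.
    by near: M; exact: dec.
  have d2 : mean (mulT (mulT ph pc) (dilT M (hatT fL))) = mean (mulT ph pc) * mean (hatT fL).
    by near: M; exact: dec.
  have d3 : mean (mulT (mulT ph pc) (dilT M (hatT fR))) = mean (mulT ph pc) * mean (hatT fR).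
    by near: M; exact: dec.
  have d4 : mean (mulT (mulT pc pc) (dilT M AL)) = mean (mulT pc pc) * mean AL.
    by near: M; exact: dec.
  have [_ mR] := nz_mean (tree_nz HR (RS sR0R)); have [_ mL] := nz_mean (tree_nz HL (LS sL0L)).
  rewrite /W !meanD meanZ d1 d2 d3 d4 mR mL !mulr0 !add0r mS.
  have p0 : 0 <= mean (mulT ph ph) by apply: mean_ge0 => y z; rewrite evM -expr2 sqr_ge0.
  have q0 : 0 <= mean (mulT pc pc) by apply: mean_ge0 => y z; rewrite evM -expr2 sqr_ge0.
  have h1 := ler_wpM2l p0 (tree_conj HR); have h2 := ler_wpM2l q0 (tree_conj HL).
  have e : (m%:R : R) * (mean (mulT ph ph) + mean (mulT pc pc)) / 4 =
    mean (mulT ph ph) * (m%:R / 4) + mean (mulT pc pc) * (m%:R / 4) by ring.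
  lra.
Unshelve. all: by end_near. Qed.

End step.

Lemma tree_exists (m : nat) S sigma : sorted <%R sigma -> size sigma = (2 ^ m)%N ->
  {subset sigma <= S} -> exists f g, tree_fun m S sigma f g.
Proof.
elim: m sigma => [|m IH] sigma ss sz sub.
  case: sigma sz ss sub => [//|s0 [|//]] _ _ sub.
  (* At depth 0 the function is zero: the sign conditions hold vacuously on the empty list, and the
     single weight is 1. *)
  exists [::], (fun=> constT 1); split => //.
  - by move=> y z; rewrite ev_nil normr0.
  - by rewrite /mulT /= mean_nil mul0r.
  - by move=> s y z; rewrite ev_const ler01.
  - by move=> y z; rewrite big_seq1 ev_const.
  - by rewrite /target /= mean_nil mul0r.
pose N := (2 ^ m)%N; have N0 : (0 < N)%N by rewrite expn_gt0.
have szN : size sigma = (N + N)%N by rewrite sz expnS mul2n addnn.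
have nlt (i j : nat) : (i < j)%N -> (j < N + N)%N -> nth 0 sigma i < nth 0 sigma j.
  by move=> ij jN; apply: (sorted_ltn_nth lt_trans 0 ss) => //; rewrite inE szN// (ltn_trans ij).
have sL : size (take N sigma) = N by rewrite size_takel// szN leq_addr.
have sR : size (drop N sigma) = N by rewrite size_drop szN addnK.
have [t [xt ty tS]] : exists t, [/\ nth 0 sigma N.-1 < t, t < nth 0 sigma N & t \notin S].
  apply: exists_between_notin; apply: nlt; first by rewrite prednK.
  by rewrite -[X in (X < _)%N]addn0 ltn_add2l.
have tL s : s \in take N sigma -> s < t.
  move=> sN; case: (nthP 0 sN) => i; rewrite sL => iN; rewrite nth_take// => <-.
  have : (i <= N.-1)%N by rewrite -ltnS prednK.
  rewrite leq_eqVlt => /predU1P[->//|iN1]; apply: lt_trans xt; apply: nlt => //.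
  by rewrite (leq_ltn_trans (leq_pred N))// -[X in (X < _)%N]addn0 ltn_add2l.
have tR s : s \in drop N sigma -> t < s.
  move=> sN; case: (nthP 0 sN) => i; rewrite sR => iN; rewrite nth_drop => <-.
  case: i iN => [|i] iN; first by rewrite addn0.
  by apply: lt_trans ty _; apply: nlt; rewrite ?ltn_add2l// -[X in (X < _)%N]addn0 ltn_add2l.
have subL : {subset take N sigma <= S} by move=> s /mem_take; exact: sub.
have subR : {subset drop N sigma <= S} by move=> s /mem_drop; exact: sub.
have [fL [gL HL]] := IH _ (take_sorted N ss) sL subL.
have [fR [gR HR]] := IH _ (drop_sorted N ss) sR subR.
rewrite -(cat_take_drop N sigma); apply: (tree_step tL tR tS subL subR _ _ HL HR).
  by exists (nth 0 (take N sigma) 0); rewrite mem_nth// sL.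
by exists (nth 0 (drop N sigma) 0); rewrite mem_nth// sR.
Qed.

End tree_induction.

(** * Gaussian waves are Schwartz functions *)

Section schwartz_class.
Context {R : realType} {n : nat}.
Implicit Types (x v w : 'rV[R]_n) (f g : 'rV[R]_n -> R) (a : R) (k : 'I_n).

Definition dot w x : R := \sum_k w ord0 k * x ord0 k.
Definition nsq x : R := \sum_k x ord0 k ^+ 2.
Definition gwave w a x : R := expR (- nsq x / 2) * cos (dot w x + a).

Lemma is_derive_line f x v (l : R) :
  is_derive (0 : R) (1 : R) (fun h : R => f (h *: v + x)) l -> is_derive x v f l.
Proof.
have e : (fun h : R => h^-1 *: (((fun h0 : R => f (h0 *: v + x)) \o shift 0) (h *: 1) - f (0 *: v + x))) =
    (fun h : R => h^-1 *: ((f \o shift x) (h *: v) - f x)).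
  apply/funext => h /=; congr (_ *: (f _ - f _)).
    by rewrite addr0 -[h *: 1]/(h * 1) mulr1.
  by rewrite scale0r add0r.
move=> [d dl]; split; first by move: d; rewrite /derivable e.
by move: dl; rewrite /derive e.
Qed.

Lemma line_coord (h : R) v x k : (h *: v + x) ord0 k = h * v ord0 k + x ord0 k.
Proof. by rewrite !mxE. Qed.

Lemma nsq_line (h : R) v x : nsq (h *: v + x) = nsq x + 2 * dot v x * h + nsq v * h ^+ 2.
Proof.
rewrite /nsq /dot mulr_sumr !mulr_suml -!big_split; apply: eq_bigr => k _.
by rewrite line_coord /=; ring.
Qed.

Lemma dot_line (h : R) w v x : dot w (h *: v + x) = dot w x + dot w v * h.
Proof.
rewrite /dot mulr_suml -big_split; apply: eq_bigr => k _; rewrite line_coord /=; ring.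
Qed.

Lemma gwave_line w a (h : R) v x : gwave w a (h *: v + x) =
  expR (qd (- nsq x / 2) (- dot v x) (- nsq v / 2) h) * cos (qd (dot w x + a) (dot w v) 0 h).
Proof.
rewrite /gwave nsq_line dot_line.
have -> : qd (- nsq x / 2) (- dot v x) (- nsq v / 2) h =
  - (nsq x + 2 * dot v x * h + nsq v * h ^+ 2) / 2 by rewrite /qd; field.
by have -> : qd (dot w x + a) (dot w v) 0 h = dot w x + dot w v * h + a by rewrite /qd; ring.
Qed.

Lemma dot_delta x k : dot (delta_mx 0 k) x = x ord0 k.
Proof.
rewrite /dot (bigD1 k)//= mxE !eqxx mul1r big1 ?addr0// => j /negbTE jk.
by rewrite mxE eqxx jk mul0r.
Qed.

Lemma dotC x w : dot x w = dot w x.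
Proof. by apply: eq_bigr => k _; rewrite mulrC. Qed.

(** Stability under partial derivatives and monomials reduces all Schwartz seminorms to the
    boundedness of the members. *)
Inductive gclass : ('rV[R]_n -> R) -> Prop :=
| Gwave w a : gclass (gwave w a)
| GcoordM k f : gclass f -> gclass (fun x => x ord0 k * f x)
| Gadd f g : gclass f -> gclass g -> gclass (fun x => f x + g x)
| Gscale c f : gclass f -> gclass (fun x => c * f x).

Lemma gclass_derive i f : gclass f ->
  exists2 f', gclass f' & forall x, is_derive x (delta_mx 0 i) f (f' x).
Proof.
elim=> [w a|k {}f Gk [f' Gf' df']|{}f g _ [f' Gf' df'] _ [g' Gg' dg']|c {}f _ [f' Gf' df']].
- exists (fun x => (-1) * (x ord0 i * gwave w a x) + (- w ord0 i) * gwave w (a - pi / 2) x).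
    by apply: Gadd; apply: Gscale; [apply: GcoordM|]; exact: Gwave.
  move=> x; apply: is_derive_line.
  have -> : (fun h : R => gwave w a (h *: 'e_i + x)) = (fun h : R =>
      expR (qd (- nsq x / 2) (- dot 'e_i x) (- nsq 'e_i / 2) h) *
      cos (qd (dot w x + a) (dot w 'e_i) 0 h)) by apply/funext => h; exact: gwave_line.
  have := is_derive_expcos (is_derive_qd (- nsq x / 2) (- dot 'e_i x) (- nsq 'e_i / 2) 0)
     (is_derive_qd (dot w x + a) (dot w 'e_i) 0 0).
  move=> [d e]; split; rewrite ?e //.
  have dw : dot w 'e_i = w ord0 i by rewrite dotC dot_delta.
  rewrite !dw !dot_delta.
  rewrite /gwave addrA cosBpihalf /qd !mulr0 expr0n /= !addr0 !mulr0 !addr0; ring.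
- exists (fun x => x ord0 k * f' x + (k == i)%:R * f x).
    by apply: Gadd; [exact: GcoordM|exact: Gscale].
  move=> x; have dk : is_derive x (delta_mx 0 i) (fun x : 'rV[R]_n => x ord0 k) ((k == i)%:R : R).
    apply: is_derive_line.
    have -> : (fun h : R => (h *: 'e_i + x : 'rV[R]_n) ord0 k) = qd (x ord0 k) ((k == i)%:R) 0.
      by apply/funext => h; rewrite line_coord mxE eqxx /qd /=; ring.
    by have [d e] := is_derive_qd (x ord0 k) ((k == i)%:R) 0 0; split; rewrite ?e // mul0r addr0.
  by have ? := df' x; apply: is_derive_eq; rewrite /GRing.scale /=; ring.
- exists (fun x => f' x + g' x); first exact: Gadd.
  by move=> x; have ? := df' x; have ? := dg' x; apply: is_derive_eq.
- exists (fun x => c * f' x); first exact: Gscale.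
  by move=> x; have ? := df' x; apply: is_derive_eq; rewrite /GRing.scale.
Qed.

Lemma continuous_sum_fun (I : Type) (r : seq I) (F : I -> 'rV[R]_n -> R) :
  (forall j, continuous (F j)) -> continuous (fun x => \sum_(j <- r) F j x).
Proof.
move=> cF; elim: r => [|j r IH].
  rewrite (_ : (fun x => _) = fun=> 0); first exact: cst_continuous.
  by apply/funext => x; rewrite big_nil.
rewrite (_ : (fun x => _) = fun x => F j x + \sum_(k <- r) F k x).
  by move=> x; apply: continuousD; [exact: cF|exact: IH].
by apply/funext => x; rewrite big_cons.
Qed.

Lemma continuous_gclass f : gclass f -> continuous f.
Proof.
elim=> [w a|k {}f _ cf|{}f g _ cf _ cg|c {}f _ cf] x.
- have c1 : continuous nsq.
    apply: continuous_sum_fun => k z.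
    by apply: (@continuousM _ _ (fun x : 'rV[R]_n => x ord0 k) (fun x => x ord0 k)); exact: coord_continuous.
  have c2 : continuous (dot w).
    apply: continuous_sum_fun => k z.
    by apply: (@continuousM _ _ (fun=> w ord0 k) (fun x : 'rV[R]_n => x ord0 k));
      [exact: cst_continuous|exact: coord_continuous].
  pose e u : R := expR (qd 0 (- 1 / 2) 0 u); pose c u : R := cos (qd a 1 0 u).
  have ce : continuous e by move=> u; exact: continuous_comp (@continuous_qd _ _ _ _ u) (@continuous_expR R _).
  have cc : continuous c by move=> u; exact: continuous_comp (@continuous_qd _ _ _ _ u) (@continuous_cos R _).
  have -> : gwave w a = (fun x => (e \o nsq) x * (c \o dot w) x).
    apply/funext => y; rewrite /gwave /e /c /=.
    by congr (expR _ * cos _); rewrite /qd; ring.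
  apply: (@continuousM _ _ (e \o nsq) (c \o dot w)).
    exact: continuous_comp (c1 x) (ce _).
  exact: continuous_comp (c2 x) (cc _).
- by apply: (@continuousM _ _ (fun x : 'rV[R]_n => x ord0 k) f); [exact: coord_continuous|exact: cf].
- by apply: (@continuousD _ _ _ f g); [exact: cf|exact: cg].
- by apply: (@continuousM _ _ (fun=> c) f); [exact: cst_continuous|exact: cf].
Qed.

Lemma nsq_ge0 x : 0 <= nsq x.
Proof. by apply: sumr_ge0 => k _; exact: sqr_ge0. Qed.

Lemma coord_le_nsq x k : `|x ord0 k| <= 1 + nsq x.
Proof.
have h : x ord0 k ^+ 2 <= nsq x.
  by rewrite /nsq (bigD1 k)//= lerDl sumr_ge0// => j _; exact: sqr_ge0.
have e : x ord0 k ^+ 2 = `|x ord0 k| ^+ 2 by rewrite real_normK// num_real.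
rewrite e in h; have := sqr_ge0 (`|x ord0 k| - 1 / 2).
set y := `|_| in h * => h2; nra.
Qed.

(** A coordinate factor costs a little of the Gaussian rate, so the induction needs the bound for
    every [d < 1 / 2] rather than for one fixed rate. *)
Lemma gclass_bound f : gclass f -> forall d : R, d < 1 / 2 ->
  exists2 C : R, 0 <= C & forall x, `|f x| <= C * expR (- d * nsq x).
Proof.
elim=> [w a|k {}f _ IH|{}f g _ IHf _ IHg|c {}f _ IH] d d0.
- exists 1 => // x; rewrite mul1r /gwave normrM ger0_norm ?expR_ge0//.
  rewrite -[leRHS]mulr1; apply: ler_pM; rewrite ?expR_ge0 ?norm_cos_le1//.
  have := nsq_ge0 x; rewrite ler_expR => q0; nra.
(* The rate is taken halfway between [d] and [1 / 2]; the surplus [e] over [d] pays for the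
   coordinate. *)
- have [C C0 h] := IH ((d + 1 / 2) / 2) ltac:(lra).
  pose e := (1 / 2 - d) / 2; have e0 : 0 < e by rewrite /e; lra.
  exists ((1 + e^-1) * C) => [|x]; first by rewrite mulr_ge0// addr_ge0// invr_ge0 ltW.
  rewrite normrM -mulrA; have q0 := nsq_ge0 x.
  have h1 : `|x ord0 k| <= (1 + e^-1) * expR (e * nsq x).
    apply: le_trans (coord_le_nsq x k) _; rewrite mulrDl; apply: lerD.
      by rewrite mul1r -expR0 ler_expR mulr_ge0// ltW.
    rewrite -[leLHS]mul1r -[X in X * _](mulVf (lt0r_neq0 e0)) -mulrA ler_wpM2l ?invr_ge0 ?(ltW e0)//.
    by apply: le_trans (expR_ge1Dx _); rewrite lerDr.
  apply: le_trans (ler_pM _ _ h1 (h x)) _ => //.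
  rewrite le_eqVlt; apply/orP; left; apply/eqP.
  have -> : expR (- d * nsq x) = expR (e * nsq x) * expR (- ((d + 1 / 2) / 2) * nsq x).
    by rewrite -expRD; congr expR; rewrite /e; field.
  ring.
- have [C C0 h] := IHf d d0; have [C' C'0 h'] := IHg d d0.
  exists (C + C') => [|x]; first exact: addr_ge0.
  by rewrite mulrDl; apply: le_trans (ler_normD _ _) (lerD (h x) (h' x)).
- have [C C0 h] := IH d d0; exists (`|c| * C) => [|x]; first exact: mulr_ge0.
  by rewrite normrM -mulrA ler_wpM2l.
Qed.

Lemma gclass_monomial (a : 'I_n -> nat) f : gclass f ->
  gclass (fun x => (\prod_k x ord0 k ^+ a k) * f x).
Proof.
move=> Gf; pose P (r : seq 'I_n) := fun x => (\prod_(k <- r) x ord0 k ^+ a k) * f x.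
suff h r : gclass (P r) by exact: h.
elim: r => [|k r IH].
  by have -> : P [::] = f by apply/funext => x; rewrite /P big_nil mul1r.
have -> : P (k :: r) = fun x => x ord0 k ^+ a k * P r x.
  by apply/funext => x; rewrite /P big_cons mulrA.
elim: (a k) => [|m IHm].
  by have -> : (fun x => x ord0 k ^+ 0 * P r x) = P r by apply/funext => x; rewrite expr0 mul1r.
have -> : (fun x => x ord0 k ^+ m.+1 * P r x) = fun x => x ord0 k * (x ord0 k ^+ m * P r x).
  by apply/funext => x; rewrite exprS mulrA.
exact: GcoordM.
Qed.

Lemma gclass_iter_partial (s : seq 'I_n) f : gclass f -> gclass (iter_partial s f).
Proof.
move=> Gf; elim: s => [//|i s IH] /=.
have [f' Gf' df'] := gclass_derive i IH.
have -> : partial i (foldr partial f s) = f'; last by [].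
by apply/funext => x; have ? := df' x; rewrite /partial; apply: derive_val.
Qed.

Lemma gclass_schwartz f : gclass f -> schwartz_real f.
Proof.
move=> Gf; split.
  move=> s; have Gs := gclass_iter_partial s Gf; split; first exact: continuous_gclass.
  by move=> i x; have [f' _ df'] := gclass_derive i Gs; have [] := df' x.
move=> a s; have Gs := gclass_monomial a (gclass_iter_partial s Gf).
have [C C0 h] := gclass_bound Gs (d := 0) ltac:(lra).
by exists C => x; apply: le_trans (h x) _; rewrite oppr0 mul0r expR0 mulr1.
Qed.

Lemma gclass_sum (I : Type) (r : seq I) (F : I -> 'rV[R]_n -> R) :
  (forall j, gclass (F j)) -> gclass (fun x => \sum_(j <- r) F j x).
Proof.
move=> GF; elim: r => [|j r IH].
  have -> : (fun x => \sum_(j <- [::]) F j x) = fun x => 0 * gwave 0 0 x.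
    by apply/funext => x; rewrite big_nil mul0r.
  by apply: Gscale; exact: Gwave.
have -> : (fun x => \sum_(k <- j :: r) F k x) = fun x => F j x + \sum_(k <- r) F k x.
  by apply/funext => x; rewrite big_cons.
exact: Gadd.
Qed.

End schwartz_class.

(** * The directional Hilbert transform at high frequency *)

Section hilbert_estimate.
Context {R : realType} {n : nat}.
Variables (i l : 'I_n).
Implicit Types (x v : 'rV[R]_n) (M : R) (T : @trig R).
Local Notation mu := (@lebesgue_measure R).
Local Notation Z := (gaussZ (1 : R)).

Definition wvec M (p q : R) : 'rV[R]_n :=
  \row_k (M * (p * (k == i)%:R + q * (k == l)%:R)).

Definition testF T M x : R :=
  \sum_(m <- T) (let: (c, p, q, a) := m in c * gwave (wvec M p q) a x).

Lemma dot_wvec M p q x : dot (wvec M p q) x = M * (p * x ord0 i + q * x ord0 l).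
Proof.
have D (k : 'I_n) : \sum_j (j == k)%:R * x ord0 j = x ord0 k.
  rewrite (bigD1 k)//= eqxx mul1r big1 ?addr0// => j /negbTE ->; exact: mul0r.
rewrite -(D i) -(D l) !mulr_sumr -big_split mulr_sumr.
by apply: eq_bigr => k _; rewrite mxE /=; ring.
Qed.

Lemma testFE T M x :
  testF T M x = expR (- nsq x / 2) * ev T (M * x ord0 i) (M * x ord0 l).
Proof.
rewrite /testF /ev mulr_sumr; apply: eq_bigr => -[[[c p] q] a] _ /=.
rewrite /gwave dot_wvec mulrCA; congr (_ * (_ * cos _)); ring.
Qed.

Lemma gclass_testF T M : gclass (testF T M).
Proof.
by apply: gclass_sum => -[[[c p] q] a]; apply: Gscale; exact: Gwave.
Qed.

Let A (eps : R) : set R := [set t | eps < `|t|].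

Let measurable_A eps : measurable (A eps).
Proof.
have -> : A eps = ~` `[- eps, eps]%classic.
  by apply/seteqP; split => t; rewrite /A /= in_itv/= -ler_norml ltNge => /negP.
by apply: measurableC; exact: measurable_itv.
Qed.

Lemma integrable_truncated b S a eps : 0 < eps -> mu.-integrable (A eps)
  (EFin \o (fun t => expR (qd 0 b (- 1 / 2) t) * cos (qd a S 0 t) / t)).
Proof.
move=> eps0.
have h1 : mu.-integrable (A eps) (EFin \o (fun t => expR (qd 0 b (- 1 / 2) t) * cos (qd a S 0 t))).
  apply: (@integrableS _ _ _ mu setT (A eps)) => //.
    exact: measurable_A.
  exact: integrable_expcos.
apply: (@integrableMl _ _ _ mu (A eps) (measurable_A eps) _ (@GRing.inv R) h1).
  by apply: measurable_funTS; exact: measurable_invr.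
exists eps^-1; split; first exact: num_real.
move=> r er t /= At; apply: le_trans (ltW er).
have t1 : 0 < `|t| := lt_trans eps0 At.
by rewrite normfV lef_pV2 ?posrE//; exact: ltW.
Qed.

Let pvA b S a eps := \int[mu]_(t in A eps) (expR (qd 0 b (- 1 / 2) t) * cos (qd a S 0 t) / t).

Lemma gwave_shift w a v x t : nsq v = 1 ->
  gwave w a (x - t *: v) =
  expR (- nsq x / 2) * (expR (qd 0 (dot v x) (- 1 / 2) t) * cos (qd (dot w x + a) (- dot w v) 0 t)).
Proof.
move=> v1; rewrite addrC -scaleNr gwave_line v1 mulrA -expRD.
by congr (expR _ * cos _); rewrite /qd; field.
Qed.

(** This is [pi] times the Hilbert transform of [testF T M]. The frequency along the line enters
    negated because the integrand is taken at [x - t v]. *)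
Definition pvsum T M v x : R := \sum_(m <- T) (let: (c, p, q, a) := m in
  c * expR (- nsq x / 2) * pvX (dot v x) (- dot (wvec M p q) v) (dot (wvec M p q) x + a)).

Lemma cvg_testF T M v x : nsq v = 1 ->
  (\int[mu]_(t in [set t | eps < `|t|]) (testF T M (x - t *: v) / t)) @[eps --> 0^'+]
  --> pvsum T M v x.
Proof.
move=> v1.
pose J eps T := \sum_(m <- T) (let: (c, p, q, a) := m in
  c * expR (- nsq x / 2) * pvA (dot v x) (- dot (wvec M p q) v) (dot (wvec M p q) x + a) eps).
have JE eps : 0 < eps -> forall T, mu.-integrable (A eps) (EFin \o (fun t => testF T M (x - t *: v) / t)) /\
    \int[mu]_(t in A eps) (testF T M (x - t *: v) / t) = J eps T.
  move=> eps0; elim=> [|[[[c p] q] a] T' [IH1 IH2]].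
    rewrite /J big_nil; split.
      apply: (@eq_integrable _ _ _ mu (A eps) (measurable_A eps) (cst 0%E)).
        by move=> t _; rewrite /testF /= big_nil mul0r.
      exact: integrable0.
    under eq_Rintegral do rewrite /testF big_nil mul0r.
    by rewrite /Rintegral integral0.
  pose k := c * expR (- nsq x / 2).
  pose u t := expR (qd 0 (dot v x) (- 1 / 2) t) *
     cos (qd (dot (wvec M p q) x + a) (- dot (wvec M p q) v) 0 t) / t.
  have iu := integrable_truncated (dot v x) (- dot (wvec M p q) v) (dot (wvec M p q) x + a) eps0.
  have iku : mu.-integrable (A eps) (EFin \o (fun t => k * u t)).
    have h := @integrableZl _ _ _ mu (A eps) (measurable_A eps) k (EFin \o u) iu; exact: h.
  have e t : testF ((c, p, q, a) :: T') M (x - t *: v) / t = k * u t + testF T' M (x - t *: v) / t.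
    by rewrite /testF big_cons gwave_shift// mulrDl /k /u; congr (_ + _); ring.
  split.
    apply: (@eq_integrable _ _ _ mu (A eps) (measurable_A eps)
       (EFin \o (fun t => k * u t + testF T' M (x - t *: v) / t))).
      by move=> t _; rewrite /= e.
    have h := @integrableD _ _ _ mu (A eps) (measurable_A eps) _ _ iku IH1; exact: h.
  rewrite /J big_cons -/(J eps T') -IH2.
  transitivity (\int[mu]_(t in A eps) (k * u t + testF T' M (x - t *: v) / t)).
    by apply: eq_Rintegral => t _; rewrite e.
  rewrite (@RintegralD _ _ _ mu (A eps) _ _ (measurable_A eps) iku IH1); congr (_ + _).
  exact: (@RintegralZl _ _ _ mu (A eps) u k (measurable_A eps) iu).
have cJ T' : J eps T' @[eps --> 0^'+] --> pvsum T' M v x.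
  rewrite /J /pvsum; elim: T' => [|[[[c p] q] a] T' IH].
    rewrite big_nil; rewrite (_ : (fun eps => _) = fun=> 0); first exact: cvg_cst.
    by apply/funext => eps; rewrite big_nil.
  rewrite big_cons; under eq_fun do rewrite big_cons.
  by apply: cvgD => //; apply: cvgM; [exact: cvg_cst|exact: cvg_pv].
apply: cvg_trans (cJ T); apply: near_eq_cvg; near=> eps.
have eps0 : 0 < eps by near: eps; exact: nbhs_right_gt.
by rewrite (JE eps eps0 T).2.
Unshelve. all: by end_near. Qed.

Lemma hilbert_testF T M v x : nsq v = 1 ->
  hilbert_real v (testF T M) x = pi^-1 * pvsum T M v x.
Proof.
by move=> v1; rewrite /hilbert_real; congr (_ * _); apply: cvg_lim => //; exact: cvg_testF.
Qed.

(** The component of [x] orthogonal to [v] has nonnegative squared norm. *)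
Lemma dot_sq_le v x : nsq v = 1 -> dot v x ^+ 2 <= nsq x.
Proof.
move=> v1; rewrite -subr_ge0; have := nsq_ge0 ((- dot v x) *: v + x).
by rewrite nsq_line v1 => h; apply: le_trans h _; rewrite le_eqVlt; apply/orP; left; apply/eqP; ring.
Qed.

Let rho T M v : R := \sum_(m <- T) (let: (c, p, q, a) := m in
  `|c| * (Z * expR (1 / 2 - `|dot (wvec M p q) v|))).

Let Z0 : 0 <= Z. Proof. by rewrite ltW// gaussZ_gt0. Qed.

(** Two errors: dropping [b], by [pvX_dist], and replacing [pvV S] by its limit. In the first,
    [b^2 <= Q] lets the Gaussian weight absorb [exp (b^2 / 2)], and
    [exp (- S^2 / 2) <= exp (1 / 2 - |S|)]. *)
Lemma pv_term_le (k : R) b S a Q : 0 <= k -> b ^+ 2 <= Q -> S != 0 ->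
  (forall S, `|Num.sg S * k - pvV S| <= k * (S == 0)%:R + Z * expR (1 / 2 - `|S|)) ->
  `|expR (- Q / 2) * pvX b (- S) a - expR (- Q / 2) * (Num.sg S * k * sin a)| <=
  (1 + `|b|) * (Z * expR (1 / 2 - `|S|)).
Proof.
move=> k0 bQ S0 hk; rewrite -mulrBr normrM ger0_norm ?expR_ge0//.
have e0 : expR (- Q / 2) <= 1.
  by rewrite expR_le1 mulNr oppr_le0 divr_ge0// (le_trans (sqr_ge0 b)).
have -> : pvX b (- S) a - Num.sg S * k * sin a =
  (pvX b (- S) a - pvX 0 (- S) a) - sin a * (Num.sg S * k - pvV S).
  by rewrite pvX0E pvVN; ring.
apply: le_trans (ler_wpM2l (expR_ge0 _) (ler_normB _ _)) _.
rewrite mulrDr [leRHS]mulrDl mul1r [leRHS]addrC; apply: lerD.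
  apply: le_trans (ler_wpM2l (expR_ge0 _) (pvX_dist _ _ _)) _.
  rewrite mulrCA ler_wpM2l// mulrCA ler_wpM2l// sqrrN -expRD ler_expR.
  have := sqr_ge0 (`|S| - 1); have e : `|S| ^+ 2 = S ^+ 2 by rewrite real_normK// num_real.
  by rewrite -e; set y := `|S| => h; nra.
have := hk S; rewrite (negbTE S0) mulr0 add0r => h.
rewrite -[leRHS]mul1r; apply: ler_pM => //; rewrite normrM -[leRHS]mul1r.
by apply: ler_pM => //; exact: norm_sin_le1.
Qed.

Lemma cvg_sum0 (I : eqType) (r : seq I) (F : I -> R -> R) :
  (forall j, j \in r -> F j M @[M --> +oo] --> (0 : R)) ->
  (\sum_(j <- r) F j M) @[M --> +oo] --> (0 : R).
Proof.
elim: r => [|j r IH] h.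
  rewrite (_ : (fun M => _) = fun=> 0); first exact: cvg_cst.
  by apply/funext => M; rewrite big_nil.
rewrite (_ : (fun M => _) = fun M => F j M + \sum_(k <- r) F k M); last first.
  by apply/funext => M; rewrite big_cons.
rewrite -[X in _ --> X](addr0 0); apply: cvgD; first exact/h/mem_head.
by apply: IH => k kr; apply: h; rewrite inE kr orbT.
Qed.

(** Along [v] a term oscillates at rate [M v_l (p s + q)], which is unbounded in [M] because [nz]
    excludes [p s + q = 0]; the error thus decays exponentially. The sign of [v_l] is common to all
    terms and disappears in the absolute value. *)
Lemma hilbert_lower : exists2 k : R, 0 < k & forall T v, nsq v = 1 -> v ord0 l != 0 ->
  nz (v ord0 i / v ord0 l) T -> exists r : R -> R,
  [/\ forall M, 0 <= r M, r M @[M --> +oo] --> (0 : R) &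
   forall M x, 0 < M ->
   k * expR (- nsq x / 2) * ev (conjT (v ord0 i / v ord0 l) T) (M * x ord0 i) (M * x ord0 l)
     - r M * (1 + `|dot v x|) <= `|hilbert_real v (testF T M) x|].
Proof.
have [k k0 hk] := @pvV_lim R.
have pi0 : 0 < pi^-1 :> R by rewrite invr_gt0 pi_gt0.
exists (pi^-1 * k); first by rewrite mulr_gt0.
move=> T v v1 vl nzT; set s := v ord0 i / v ord0 l.
have SE M p q : dot (wvec M p q) v = M * v ord0 l * (p * s + q).
  by rewrite dot_wvec /s; field.
exists (fun M => pi^-1 * rho T M v); split.
- move=> M; rewrite mulr_ge0 ?(ltW pi0)// sumr_ge0// => -[[[c p] q] a] _.
  by rewrite mulr_ge0// mulr_ge0// expR_ge0.
- rewrite -[X in _ --> X](mulr0 pi^-1); apply: cvgM; first exact: cvg_cst.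
  apply: cvg_sum0 => m /(allP nzT); rewrite sgr_eq0 -/s.
  case: m => [[[c p] q] a]; rewrite [freq _ _]/= => f0.
  rewrite -[X in _ --> X](mulr0 `|c|); apply: cvgM; first exact: cvg_cst.
  rewrite -[X in _ --> X](mulr0 Z); apply: cvgM; first exact: cvg_cst.
  pose d := `|v ord0 l * (p * s + q)|.
  have d0 : 0 < d by rewrite normr_gt0 mulf_neq0.
  apply/cvgrPdist_le => e e0; near=> M.
  have M0 : 0 < M by near: M; exact: nbhs_pinfty_gt.
  rewrite sub0r normrN ger0_norm ?expR_ge0// SE -mulrA normrM (gtr0_norm M0) -/d.
  have : ln (e^-1) + 1 / 2 <= M * d.
    by rewrite -ler_pdivrMr//; near: M; exact: nbhs_pinfty_ge.
  rewrite lnV ?posrE// => h; rewrite -[leRHS]lnK ?posrE// ler_expR; lra.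
move=> M x M0; rewrite hilbert_testF//.
set G := expR (- nsq x / 2); set b := dot v x.
have main : `|pvsum T M v x - Num.sg (v ord0 l) * (k * G * ev (conjT s T) (M * x ord0 i) (M * x ord0 l))|
    <= rho T M v * (1 + `|b|).
  rewrite /pvsum /rho /ev big_map !mulr_sumr -sumrB mulr_suml.
  apply: le_trans (ler_norm_sum _ _ _) _.
  rewrite big_seq [leRHS]big_seq; apply: ler_sum => m mT.
  have := allP nzT _ mT; rewrite sgr_eq0; case: m mT => [[[c p] q] a] _ /=; rewrite -/s => f0.
  have S0 : dot (wvec M p q) v != 0 by rewrite SE !mulf_neq0// gt_eqF.
  have h := pv_term_le (dot (wvec M p q) x + a) (ltW k0) (dot_sq_le x v1) S0 hk.
  have := ler_wpM2l (normr_ge0 c) h; rewrite -normrM.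
  have -> : c * expR (- nsq x / 2) *
      pvX (dot v x) (- dot (wvec M p q) v) (dot (wvec M p q) x + a) -
      Num.sg (v ord0 l) * (k * G * (Num.sg (p * s + q) * c *
        cos (p * (M * x ord0 i) + q * (M * x ord0 l) + (a - pi / 2)))) =
    c * (expR (- nsq x / 2) *
      pvX (dot v x) (- dot (wvec M p q) v) (dot (wvec M p q) x + a) -
      expR (- nsq x / 2) *
      (Num.sg (dot (wvec M p q) v) * k * sin (dot (wvec M p q) x + a))).
    have -> : Num.sg (dot (wvec M p q) v) = Num.sg (v ord0 l) * Num.sg (p * s + q).
      by rewrite SE !sgrM (gtr0_sg M0) mul1r.
    have -> : p * (M * x ord0 i) + q * (M * x ord0 l) + (a - pi / 2) = dot (wvec M p q) x + a - pi / 2.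
      by rewrite dot_wvec; ring.
    by rewrite cosBpihalf /G; ring.
  by move=> /le_trans; apply; rewrite le_eqVlt; apply/orP; left; apply/eqP; ring.
rewrite normrM (gtr0_norm pi0) -!mulrA -mulrBr ler_pM2l//.
set E := ev _ _ _ in main *; rewrite (mulrA k).
have sg1 : `|Num.sg (v ord0 l) * (k * G * E)| = `|k * G * E| by rewrite normrM normr_sg vl mul1r.
have h1 := lerB_dist (Num.sg (v ord0 l) * (k * G * E)) (pvsum T M v x).
rewrite sg1 distrC in h1; have h2 := ler_norm (k * G * E); lra.
Unshelve. all: by end_near. Qed.

End hilbert_estimate.

(** * Infinitely many directions give infinitely many ratios *)

Section infinite_slopes.
Context {R : realType} {n : nat}.
Implicit Types (U : set 'rV[R]_n) (v w : 'rV[R]_n) (i l : 'I_n).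

Definition slopes U i l : set R :=
  [set s | exists v, [/\ U v, v ord0 l != 0 & s = v ord0 i / v ord0 l]].

Lemma finite_rows (r : seq R) : finite_set [set w : 'rV[R]_n | forall i, w ord0 i \in r].
Proof.
have fin : finite_set [set: {ffun 'I_n -> 'I_(size r)}] by exact: finite_finset.
pose h (f : {ffun 'I_n -> 'I_(size r)}) : 'rV[R]_n := \row_i nth 0 r (f i).
apply: sub_finite_set (finite_image h fin) => w wr /=.
have ix i : (index (w ord0 i) r < size r)%N by rewrite index_mem; exact: wr.
exists [ffun i => Ordinal (ix i)] => //.
by apply/rowP => i; rewrite mxE ffunE /= nth_index//; exact: wr.
Qed.

Lemma finite_cover_seq (S : 'I_n -> set R) : (forall i, finite_set (S i)) ->
  exists r : seq R, forall i s, S i s -> s \in r.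
Proof.
move=> Sf; have /choice[rs hrs] : forall i, exists r : seq R, S i = [set` r].
  by move=> i; apply/finite_seqP.
exists (flatten [seq rs i | i <- enum 'I_n]) => i s Sis.
apply/flattenP; exists (rs i); first by apply: map_f; rewrite mem_enum.
by move: Sis; rewrite hrs.
Qed.

(* A unit vector is determined up to sign by the ratios of its coordinates to
   a nonzero one. *)
Lemma infinite_slopes U : (forall v, U v -> unit_vector v) -> infinite_set U ->
  exists i l, i != l /\ infinite_set (slopes U i l).
Proof.
move=> Uu; apply: contra_notP => H; have {}H i l : i != l -> finite_set (slopes U i l).
  by move=> il; apply: contrapT => h; apply: H; exists i, l.
have fS l i : finite_set (slopes U i l).
  have [->|il] := eqVneq i l; last exact: H.
  apply: (@sub_finite_set _ _ [set (1 : R)]); last exact: finite_set1.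
  by move=> s [v [_ vl ->]] /=; rewrite divff.
have Ul l : finite_set [set v | U v /\ v ord0 l != 0].
  have [r hr] := finite_cover_seq (fS l).
  pose W := [set w : 'rV[R]_n | forall i, w ord0 i \in r].
  (* With [w = v / v_l], normalising [w] returns [v] up to the sign of [v_l]; hence the two
     images. *)
  pose g (w : 'rV[R]_n) : 'rV[R]_n := (Num.sqrt (nsq w))^-1 *: w.
  apply: (@sub_finite_set _ _ ((g @` W) `|` ((fun w => - g w) @` W))); last first.
    by rewrite finite_setU; split; apply: finite_image; exact: finite_rows.
  move=> v [Uv vl]; pose w := (v ord0 l)^-1 *: v.
  have Ww : W w by move=> i; apply: hr; exists v; split=> //; rewrite mxE mulrC.
  have nw : nsq w = (v ord0 l ^+ 2)^-1.
    rewrite /nsq; under eq_bigr do rewrite mxE exprMn.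
    by rewrite -mulr_sumr (Uu _ Uv) mulr1 exprVn.
  have gw : g w = (`|v ord0 l| / v ord0 l) *: v.
    by rewrite /g nw sqrtrV ?sqr_ge0// sqrtr_sqr invrK /w scalerA.
  have [vn|vp|v0] := ltgtP (v ord0 l) 0; last by rewrite v0 eqxx in vl.
    right; exists w => //; rewrite gw ltr0_norm// mulNr divff// scaleN1r opprK//.
  by left; exists w => //; rewrite gw gtr0_norm// divff// scale1r.
apply: (@sub_finite_set _ _ (\bigcup_(l in [set: 'I_n]) [set v | U v /\ v ord0 l != 0])); last first.
  by apply: bigcup_finite => [|l _]; [exact: finite_finset|exact: Ul].
move=> v Uv; apply: contrapT => h.
have v0 i : v ord0 i = 0.
  by apply/eqP; apply: contra_notT h => vi; exists i.
have := Uu _ Uv; rewrite /unit_vector big1 => [/esym/eqP|i _].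
  by rewrite oner_eq0.
by rewrite v0 expr0n.
Qed.

Lemma infinite_sorted (A : set R) (N : nat) : infinite_set A ->
  exists s : seq R, [/\ sorted <%R s, size s = N & forall x, x \in s -> A x].
Proof.
move=> /(infinite_set_fset N)[B BA NB].
pose s := take N (sort <=%R (finmap.enum_fset B)).
exists s; split.
- apply: take_sorted; rewrite sort_lt_sorted; exact: finmap.fset_uniq.
- by rewrite size_takel// size_sort.
- by move=> x /mem_take; rewrite mem_sort => xB; exact: BA.
Qed.

End infinite_slopes.

(** * Pointwise and integral inequalities for p-th powers *)

Section integral_bounds.
Context {R : realType}.
Implicit Types (p : R).

(** The integral of a nonnegative function is a supremum over simple functions below it, so it is
    monotone without measurability. The maximal function over an arbitrary [U] calls for this
    generality. *)
Lemma integral_le_nonmeasurable d (T : measurableType d) (m : {measure set T -> \bar R})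
    (f g : T -> \bar R) : (forall x, 0 <= g x)%E -> (forall x, f x <= g x)%E ->
  (\int[m]_x f x <= \int[m]_x g x)%E.
Proof.
move=> g0 fg; rewrite integralE.
apply: (@le_trans _ _ (\int[m]_x (f^\+ x))%E).
  rewrite -[leRHS]sube0; apply: leeB => //; apply: integral_ge0 => x _; exact: funeneg_ge0.
rewrite !ge0_integralTE//.
apply: le_ereal_sup => _ [h hf <-]; exists h => // x.
by apply: le_trans (hf x) _; rewrite funeposE ge_max fg g0.
Qed.

Lemma powR_predM p (x : R) : 0 < x -> x `^ p = x `^ (p - 1) * x.
Proof.
move=> x0; have hx : (p - 1 + 1 == 0) ==> (x != 0) by rewrite (gt_eqF x0) implybT.
by have := powRD hx; rewrite subrK (powRr1 (ltW x0)).
Qed.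

(** Below [c] the left side is nonpositive; above it, [x^p = x^(p-1) x] and both factors are
    compared. The bound is linear in [u], so the mean of [u] alone controls the [p]-th moment. *)
Lemma poweR_lower p (X : \bar R) (c u : R) : 1 < p -> 0 < c -> (0 <= X)%E -> (u%:E <= X)%E ->
  ((c `^ (p - 1) * (u - c))%:E <= `|X| `^ p)%E.
Proof.
move=> p1 c0; case: X => [x| |//]; last first.
  move=> _ _; rewrite gee0_abs// poweRyr ?leey// gt_eqF//; lra.
move=> x0 ux; rewrite gee0_abs// poweR_EFin lee_fin; rewrite !lee_fin in x0 ux.
have [uc|cu] := leP u c.
  apply: (@le_trans _ _ 0); last exact: powR_ge0.
  by rewrite mulr_ge0_le0 ?powR_ge0// subr_le0.
have cx : c <= x by rewrite (le_trans (ltW cu)).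
rewrite (powR_predM p (lt_le_trans c0 cx)).
apply: ler_pM; rewrite ?powR_ge0 ?subr_ge0 ?(ltW cu)//; last by lra.
by apply: ge0_ler_powR; rewrite ?nnegrE ?(ltW c0)//; lra.
Qed.

(** Either [y <= b], or [y^p <= 1 <= (y / b)^2]. Only a mean square is then needed, for [p] on
    either side of 2. *)
Lemma powR_upper p (y b : R) : 1 < p -> 0 < b -> 0 <= y -> y <= 1 ->
  y `^ p <= b `^ p + b ^- 2 * y ^+ 2.
Proof.
move=> p1 b0 y0 y1; have p0 : 0 <= p by lra.
have [yb|by_] := leP y b.
  apply: (@le_trans _ _ (b `^ p)); first by apply: ge0_ler_powR; rewrite ?nnegrE ?(ltW b0).
  by rewrite lerDl mulr_ge0 ?sqr_ge0// invr_ge0 sqr_ge0.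
apply: (@le_trans _ _ 1).
  apply: (@le_trans _ _ (1 `^ p)); last by rewrite powR1.
  by apply: ge0_ler_powR; rewrite ?nnegrE.
apply: (@le_trans _ _ (b ^- 2 * y ^+ 2)); last by rewrite lerDr powR_ge0.
by rewrite mulrC ler_pdivlMr ?exprn_gt0// mul1r lerXn2r ?nnegrE ?(ltW b0)// ltW.
Qed.

Lemma powR_tgauss n p (t : n.-tuple (measurableTypeR R)) (r : R) :
  tgauss p t `^ r = tgauss (p * r) t.
Proof. by rewrite /tgauss -expRM; congr expR; ring. Qed.

Lemma integrable_gauss_sq n (q : R) : 0 < q ->
  (@lebesgue_tuple R n).-integrable setT
    (EFin \o (fun t : n.-tuple (measurableTypeR R) => tgauss q t * (2 + tsq t))).
Proof.
move=> q0; pose e := q / 4; have e0 : 0 < e by rewrite divr_gt0.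
have q2 : 0 < q / 2 by rewrite divr_gt0.
have [h _] := tuple_gauss q2 (fun _ : 'I_n => 0) 0.
apply: (le_integrable measurableT _ _ (integrableZl measurableT (2 + e^-1) h)).
  apply/measurable_EFinP; apply: measurable_funM; first exact: measurable_tgauss.
  by apply: measurable_funD => //; exact: measurable_tsq.
move=> t _ /=; rewrite lee_fin.
have s0 : 0 <= tsq t by apply: sumr_ge0 => k _; exact: sqr_ge0.
rewrite (_ : tdot _ t = 0); last by rewrite /tdot big1// => k _; rewrite mul0r.
have c0 : 0 <= 2 + e^-1 by rewrite addr_ge0// invr_ge0 ltW.
rewrite addr0 cos0 mulr1 !ger0_norm ?mulr_ge0 ?expR_ge0// ?addr_ge0//.
have -> : tgauss q t = tgauss (q / 2) t * expR (- (e * tsq t)).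
  by rewrite /tgauss -expRD; congr expR; rewrite /e; field.
rewrite -mulrA [leRHS]mulrC; apply: ler_wpM2l; first exact: expR_ge0.
rewrite expRN mulrC ler_pdivrMr ?expR_gt0//.
have es0 : 0 <= e * tsq t by rewrite mulr_ge0// ltW.
have h1 := expR_ge1Dx (e * tsq t).
have hts : e^-1 * (e * tsq t) = tsq t by rewrite mulrA mulVf ?mul1r// gt_eqF.
rewrite [leRHS]mulrDl -[in leLHS]hts; apply: lerD; first by lra.
by apply: ler_wpM2l; [rewrite invr_ge0 ltW|lra].
Qed.

End integral_bounds.

(** * Lower bound for the maximal Hilbert transform of the test functions *)

Section counterexample.
Context {R : realType} {n : nat}.
Variables (U : set 'rV[R]_n) (i l : 'I_n).
Hypothesis hU : forall v, U v -> unit_vector v.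
Hypothesis Sinf : infinite_set (slopes U i l).
Local Notation leb := (@lebesgue_tuple R n).
Local Notation row := (@row_of_tuple R n).

Lemma nsq_row (t : n.-tuple (measurableTypeR R)) : nsq (row t) = tsq t.
Proof. by apply: eq_bigr => k _; rewrite mxE. Qed.

Lemma conjT_scale (c s : R) (T : @trig R) y z :
  ev (conjT s (scaleT c T)) y z = c * ev (conjT s T) y z.
Proof.
by rewrite /ev !big_map mulr_sumr; apply: eq_bigr => -[[[c' p'] q'] a'] _ /=; ring.
Qed.

Lemma normalized_tree (m : nat) : (0 < m)%N -> exists (sigma : seq R) (T : @trig R) (g : R -> @trig R),
  [/\ forall s, s \in sigma -> slopes U i l s /\ nz s T,
      forall y z, `|ev T y z| <= 1,
      mean (mulT T T) <= (2 * m%:R)^-1,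
      (forall s y z, 0 <= ev (g s) y z) /\ (forall y z, \sum_(s <- sigma) ev (g s) y z = 1) &
      1 / 4 <= mean (target sigma T g)].
Proof.
move=> m0; have m1 : 0 < m%:R :> R by rewrite ltr0n.
have [sigma [ss sz sU]] := infinite_sorted (2 ^ m) Sinf.
have [f [g H]] := tree_exists ss sz (fun s (h : s \in sigma) => h).
pose T := scaleT m%:R^-1 f; exists sigma, T, g; split.
- move=> s sS; split; first exact: sU.
  have := tree_nz H sS; rewrite /nz /sgn_in /T all_map.
  by apply: sub_all => -[[[c' p'] q'] a'].
- move=> y z; rewrite evZ normrM normfV (gtr0_norm m1) ler_pdivrMl// mulr1.
  exact: (tree_le H).
- have -> : mean (mulT T T) = m%:R^-1 ^+ 2 * mean (mulT f f).
    by rewrite -meanZ; apply: eq_mean => y z; rewrite evZ !evM !evZ; ring.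
  have h := ler_wpM2l (sqr_ge0 m%:R^-1) (tree_sq H).
  apply: le_trans h _; rewrite le_eqVlt; apply/orP; left; apply/eqP.
  by field; rewrite gt_eqF.
- by split; [exact: (tree_g0 H)|exact: (tree_g1 H)].
- have -> : mean (target sigma T g) = m%:R^-1 * mean (target sigma f g).
    rewrite -meanZ; apply: eq_mean => y z; rewrite evZ /target !ev_flatten mulr_sumr.
    by apply: eq_bigr => s _; rewrite !evM conjT_scale; ring.
  have h := tree_conj H; rewrite ler_pdivlMl//; lra.
Qed.

Definition testC (T : @trig R) M (x : 'rV[R]_n) : R[i] := Complex (testF i l T M x) 0.

Lemma testC_schwartz T M : schwartz (testC T M).
Proof.
split; apply: gclass_schwartz; rewrite /testC /=; first exact: gclass_testF.
have -> : (fun=> 0 : R) = (fun x : 'rV[R]_n => 0 * gwave 0 0 x) by apply/funext => x; rewrite mul0r.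
by apply: Gscale; exact: Gwave.
Qed.

Lemma le_max_hilbert (f : 'rV[R]_n -> R[i]) v x : U v ->
  (`|hilbert_real v (fun y => complex.Re (f y)) x|%:E <= max_hilbert U f x)%E.
Proof.
move=> Uv; apply: (@le_trans _ _ (Normc.normc (hilbert v f x))%:E).
  rewrite lee_fin /= -sqrtr_sqr ler_wsqrtr// lerDl sqr_ge0//.
by apply: ereal_sup_ubound; exists v.
Qed.

Lemma dot_le (v x : 'rV[R]_n) : nsq v = 1 -> 1 + `|dot v x| <= 2 + nsq x.
Proof.
move=> v1; have h := dot_sq_le x v1.
have e : dot v x ^+ 2 = `|dot v x| ^+ 2 by rewrite real_normK// num_real.
rewrite e in h; have := sqr_ge0 (`|dot v x| - 1 / 2).
set y := `|_| in h * => h2; nra.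
Qed.

(** Each ratio in [sigma] is realised by some [v] in [U], and a convex combination of lower bounds
    for one number is a lower bound. The constant [k] depends neither on [sigma] nor on [T], which
    matters when the depth is chosen last. *)
Lemma max_hilbert_lower : exists2 k : R, 0 < k & forall (sigma : seq R) T g,
  (forall s, s \in sigma -> slopes U i l s /\ nz s T) ->
  (forall s y z, 0 <= ev (g s) y z) -> (forall y z, \sum_(s <- sigma) ev (g s) y z = 1) ->
  exists2 r : R -> R, r M @[M --> +oo] --> (0 : R) & forall M x, 0 < M ->
  ((k * expR (- nsq x / 2) * ev (target sigma T g) (M * x ord0 i) (M * x ord0 l)
     - r M * (2 + nsq x))%:E <= max_hilbert U (testC T M) x)%E.
Proof.
have [k k0 hk] := @hilbert_lower R n i l.
exists k => // sigma T g hs g0 g1.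
have /choice[rv hrv] : forall s, exists rv : 'rV[R]_n * (R -> R), s \in sigma ->
   [/\ U rv.1, forall M, 0 <= rv.2 M, rv.2 M @[M --> +oo] --> (0 : R) & forall M x, 0 < M ->
    k * expR (- nsq x / 2) * ev (conjT s T) (M * x ord0 i) (M * x ord0 l)
     - rv.2 M * (2 + nsq x) <= `|hilbert_real rv.1 (testF i l T M) x|].
  move=> s; have [sS|] := boolP (s \in sigma); last by move=> _; exists (0, fun=> 0).
  have [[v [Uv vl sE]] nzs] := hs s sS; rewrite sE in nzs.
  have v1 : nsq v = 1 := hU Uv.
  have [r [r0 rc hr]] := hk T v v1 vl nzs.
  exists (v, r) => _; split => // M x M0; rewrite sE; apply: le_trans (hr M x M0).
  by rewrite lerD2l lerN2 ler_wpM2l//; exact: dot_le.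
(* The errors are nonnegative, so their sum dominates each of them; being finite, it still tends to
   0. *)
exists (fun M => \sum_(s <- sigma) (rv s).2 M).
  by apply: cvg_sum0 => s sS; have [] := hrv s sS.
move=> M x M0; pose X := max_hilbert U (testC T M) x.
have XH s : s \in sigma -> (`|hilbert_real (rv s).1 (testF i l T M) x|%:E <= X)%E.
  by move=> sS; have [Us _ _ _] := hrv s sS; exact: (le_max_hilbert (testC T M) x Us).
have [s0 s0S] : exists s0, s0 \in sigma.
  case: (sigma) g1 => [|s sg] g1; last by exists s; exact: mem_head.
  by have := g1 0 0; rewrite big_nil => /esym/eqP; rewrite oner_eq0.
rewrite -/X; have X0 : (0 <= X)%E by apply: le_trans (XH _ s0S); rewrite lee_fin.
case: X X0 XH => [u|_ _|//]; last exact: leey.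
rewrite !lee_fin => u0 XH.
set y := M * x ord0 i; set z := M * x ord0 l; set Q := 2 + nsq x.
have Q0 : 0 <= Q by rewrite addr_ge0// nsq_ge0.
have R0 s : s \in sigma -> 0 <= (rv s).2 M by move=> sS; have [] := hrv s sS.
set rr := \sum_(s <- sigma) (rv s).2 M.
have rs s : s \in sigma -> (rv s).2 M <= rr.
  move=> sS; rewrite /rr (big_rem s)//= lerDl big_seq sumr_ge0// => s' /mem_rem; exact: R0.
have -> : k * expR (- nsq x / 2) * ev (target sigma T g) y z - rr * Q =
   \sum_(s <- sigma) ev (g s) y z * (k * expR (- nsq x / 2) * ev (conjT s T) y z - rr * Q).
  rewrite /target ev_flatten mulr_sumr -[X in _ - X]mul1r -(g1 y z) mulr_suml -sumrB.
  by apply: eq_bigr => s _; rewrite evM; ring.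
have -> : u = \sum_(s <- sigma) ev (g s) y z * u by rewrite -mulr_suml g1 mul1r.
rewrite big_seq [leRHS]big_seq; apply: ler_sum => s sS.
apply: ler_wpM2l => //; have := XH s sS; rewrite lee_fin; apply: le_trans.
have [_ _ _ /(_ M x M0)] := hrv s sS; apply: le_trans.
by rewrite lerD2l lerN2 ler_wpM2r// rs.
Qed.

End counterexample.

(** * From the norm inequality to an inequality between means *)

Section norm_inequality.
Context {R : realType} {n : nat}.
Variables (U : set 'rV[R]_n) (p : R) (i l : 'I_n).
Hypotheses (il : i != l) (hp : 1 < p).
Local Notation leb := (@lebesgue_tuple R n).
Local Notation row := (@row_of_tuple R n).

Lemma max_hilbert_ge0 (f : 'rV[R]_n -> R[i]) x : U !=set0 -> (0 <= max_hilbert U f x)%E.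
Proof.
by move=> [v Uv]; apply: le_trans (le_max_hilbert f x Uv); rewrite lee_fin.
Qed.

(** The [p]-th power of the Gaussian factor is the Gaussian of parameter [p], whence the average
    [gavg i l p]. *)
Lemma le_integral_test (T : @trig R) (M b : R) : 0 < b -> (forall y z, `|ev T y z| <= 1) ->
  (\int[leb]_t (`|(Normc.normc (testC i l T M (row t)))%:E| `^ p) <=
   (gavg i l p (constT (b `^ p) ++ scaleT (b ^- 2) (mulT T T)) M)%:E)%E.
Proof.
have p0 : 0 < p := lt_trans ltr01 hp.
move=> b0 T1; rewrite /gavg -EFin_Rintegral; last exact: integrable_gauss_ev.
set f := fun t => (`|_| `^ p)%E; set g := fun t => _%:E.
suff fg t : (f t <= g t)%E.
  by apply: integral_le_nonmeasurable => // t; apply: le_trans (fg t); exact: poweR_ge0.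
have -> : f t = (`|testF i l T M (row t)| `^ p)%:E.
  by rewrite /f /testC /= expr0n /= addr0 sqrtr_sqr normr_id.
rewrite lee_fin testFE nsq_row !mxE.
set Y := ev T _ _.
have -> : expR (- tsq t / 2) = tgauss 1 t by rewrite /tgauss mulN1r.
rewrite normrM (ger0_norm (expR_ge0 _)) powRM ?expR_ge0// powR_tgauss mul1r.
apply: ler_wpM2l; first exact: expR_ge0.
rewrite evD ev_const evZ evM -expr2 -/Y.
have -> : Y ^+ 2 = `|Y| ^+ 2 by rewrite real_normK// num_real.
by apply: powR_upper => //; exact: T1.
Qed.

(** The threshold in [poweR_lower] is [c] times the Gaussian at the point: its power [p - 1] then
    combines with the Gaussian of the main term into the parameter [p], as on the other side of the
    inequality. *)
Lemma ge_integral_max (X : 'rV[R]_n -> \bar R) (Y : @trig R) (k c r M : R) : 0 < c ->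
  (forall x, 0 <= X x)%E ->
  (forall x, (k * expR (- nsq x / 2) * ev Y (M * x ord0 i) (M * x ord0 l)
              - r * (2 + nsq x))%:E <= X x)%E ->
  ((c `^ (p - 1) * (gavg i l p (scaleT k Y ++ constT (- c)) M
      - r * \int[leb]_t (tgauss (p - 1) t * (2 + tsq t))))%:E
   <= \int[leb]_t (`|X (row t)| `^ p))%E.
Proof.
move=> c0 X0 XY; have p0 : 0 < p := lt_trans ltr01 hp.
have p1 : 0 < p - 1 by rewrite subr_gt0.
set Z := scaleT _ _ ++ _.
have iZ := integrable_gauss_ev il p0 Z M.
have iQ := integrable_gauss_sq n p1.
have irQ := integrableZl measurableT r iQ.
have iB := integrableB measurableT iZ irQ.
have iC := integrableZl measurableT (c `^ (p - 1)) iB.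
rewrite /gavg -(RintegralZl _ measurableT iQ) -(RintegralB measurableT iZ irQ).
rewrite -(RintegralZl _ measurableT iB) -(EFin_Rintegral iC).
apply: integral_le_nonmeasurable => t; first exact: poweR_ge0.
have G0 : 0 < tgauss 1 t := expR_gt0 _.
have := poweR_lower hp (mulr_gt0 c0 G0) (X0 (row t)) (XY (row t)).
apply: le_trans; rewrite lee_fin nsq_row !mxE.
rewrite (powRM _ (ltW c0) (ltW G0)) powR_tgauss mul1r.
have -> : tgauss p t = tgauss (p - 1) t * tgauss 1 t.
  by rewrite /tgauss -expRD; congr expR; ring.
have -> : expR (- tsq t / 2) = tgauss 1 t by rewrite /tgauss mulN1r.
by rewrite /Z evD evZ ev_const le_eqVlt; apply/orP; left; apply/eqP; ring.
Qed.

(** As [M] grows the error term vanishes, both Gaussian averages become means, and the common factor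
    [gaussZ p ^+ n] cancels. *)
Lemma bounded_mean (A : R) (T Y : @trig R) (k c b : R) (r : R -> R) : U !=set0 ->
  0 < c -> 0 < b -> (forall y z, `|ev T y z| <= 1) -> r M @[M --> +oo] --> (0 : R) ->
  (forall M x, 0 < M -> ((k * expR (- nsq x / 2) * ev Y (M * x ord0 i) (M * x ord0 l)
              - r M * (2 + nsq x))%:E <= max_hilbert U (testC i l T M) x)%E) ->
  (forall f : 'rV[R]_n -> R[i], schwartz f -> (Lp_norm p (max_hilbert U f)
        <= A%:E * Lp_norm p (fun x => (Normc.normc (f x))%:E))%E) ->
  c `^ (p - 1) * (k * mean Y - c) <= `|A| `^ p * (b `^ p + b ^- 2 * mean (mulT T T)).
Proof.
move=> U0 c0 b0 T1 r0 hlow hA; have p0 : 0 < p := lt_trans ltr01 hp.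
pose Z := scaleT k Y ++ constT (- c).
pose W := constT (b `^ p) ++ scaleT (b ^- 2) (mulT T T).
pose C := \int[leb]_t (tgauss (p - 1) t * (2 + tsq t)).
have bound : \forall M \near +oo,
    c `^ (p - 1) * (gavg i l p Z M - r M * C) <= `|A| `^ p * gavg i l p W M.
  near=> M; have M0 : 0 < M by near: M; exact: nbhs_pinfty_gt.
  have X0 x : (0 <= max_hilbert U (testC i l T M) x)%E by exact: max_hilbert_ge0.
  rewrite -lee_fin; apply: le_trans (ge_integral_max c0 X0 (fun x => hlow M x M0)) _.
  rewrite EFinM; apply: le_trans (lee_wpmul2l _ (le_integral_test M b0 T1)); last first.
    by rewrite lee_fin powR_ge0.
  have h := hA _ (testC_schwartz i l T M); rewrite /Lp_norm in h.
  have N0 (f : n.-tuple (measurableTypeR R) -> \bar R) : (0 <= 'N[leb]_p%:E [f])%E.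
    exact: Lnorm_ge0.
  rewrite -!(poweR_Lnorm _ _ (lt0r_neq0 p0)) -poweR_EFin -poweRM ?lee_fin//.
  apply: (gt0_ler_poweR (ltW p0)); rewrite ?in_itv /= ?leey ?andbT.
  - exact: N0.
  - by apply: mule_ge0; [rewrite lee_fin|exact: N0].
  (* The constant [A] may be negative, so it is replaced by [|A|] before powers are taken. *)
  - apply: le_trans h _; apply: lee_wpmul2r; [exact: N0|by rewrite lee_fin ler_norm].
have cL : c `^ (p - 1) * (gavg i l p Z M - r M * C) @[M --> +oo] -->
    c `^ (p - 1) * (gaussZ p ^+ n * mean Z - 0 * C).
  apply: cvgM; first exact: cvg_cst.
  by apply: cvgB; [exact: cvg_gavg|apply: cvgM => //; exact: cvg_cst].
have cR : `|A| `^ p * gavg i l p W M @[M --> +oo] --> `|A| `^ p * (gaussZ p ^+ n * mean W).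
  by apply: cvgM; [exact: cvg_cst|exact: cvg_gavg].
have := ler_cvg_to cL cR bound.
have Z0 : 0 < gaussZ p ^+ n by rewrite exprn_gt0// gaussZ_gt0.
rewrite mul0r subr0 !(mulrCA _ (gaussZ p ^+ n)) ler_pM2l//.
by move=> /(_ proper_pinfty_nbhs); rewrite /Z /W !meanD !meanZ !mean_const.
Unshelve. all: by end_near. Qed.

End norm_inequality.

Theorem theorem1p2 (R : realType) (n : nat) (U : set 'rV[R]_n) (p : R)
    (hn : (2 <= n)%N) (hU : forall v, U v -> unit_vector v)
    (Uinf : infinite_set U) (hp : 1 < p) :
  ~ exists A : R, forall f : 'rV[R]_n -> R[i], schwartz f ->
      (Lp_norm p (max_hilbert U f)
        <= A%:E * Lp_norm p (fun x => (Normc.normc (f x))%:E))%E.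
Proof.
move=> [A hA]; have [i [l [il Sinf]]] := infinite_slopes hU Uinf.
have [k k0 hk] := max_hilbert_lower i l hU.
(* Chosen so that [k / 4 - c = c]: the left side of [bounded_mean] is then at least [P c]. *)
pose c := k / 8; have c0 : 0 < c by rewrite divr_gt0.
pose a := `|A|; have a0 : 0 <= a by exact: normr_ge0.
have a1 : 0 < 2 * (a + 1) by lra.
(* This gives [a b <= c / 2], hence [a^p b^p <= (c / 2)^p <= P c / 2]; the [+ 1] covers [a = 0]. *)
pose b := c / (2 * (a + 1)); have b0 : 0 < b by rewrite divr_gt0.
pose P := c `^ (p - 1); have P0 : 0 < P by exact: powR_gt0.
pose E := a `^ p * b ^- 2.
have E0 : 0 <= E by rewrite mulr_ge0 ?powR_ge0// invr_ge0 sqr_ge0.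
have Pc0 : 0 < P * c by rewrite mulr_gt0.
(* The depth comes last: with mean square at most [1 / (2 m)], the other half of the right side
   falls strictly below [P c / 2]. *)
pose m := Num.bound (E / (P * c)).
have hm : E < P * c * m%:R.
  by rewrite -ltr_pdivrMl// mulrC archi_boundP// divr_ge0// ltW.
have m0 : (0 < m)%N.
  by rewrite lt0n; apply: contraTneq hm => ->; rewrite mulr0 -leNgt.
have m1 : 0 < m%:R :> R by rewrite ltr0n.
have [sigma [T [g [hs T1 T2 [g0 g1] Y4]]]] := normalized_tree Sinf m0.
have [r r0 hlow] := hk sigma T g hs g0 g1.
have := bounded_mean il hp (infinite_setN0 Uinf) c0 b0 T1 r0 hlow hA.
rewrite -/P -/a; apply/negP; rewrite -ltNge.
have h1 : a `^ p * b `^ p <= P * (c / 2).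
  have c2 : 0 < c / 2 by rewrite divr_gt0.
  rewrite -powRM ?(ltW b0)//; apply: (@le_trans _ _ ((c / 2) `^ p)).
    apply: ge0_ler_powR; rewrite ?nnegrE ?(ltW c2) ?(mulr_ge0 a0 (ltW b0))//; first by lra.
    rewrite /b mulrCA; apply: ler_wpM2l; first exact: ltW.
    by rewrite ler_pdivrMr//; lra.
  rewrite (powR_predM p c2) ler_pM2r//.
  by apply: ge0_ler_powR; rewrite ?nnegrE ?(ltW c0) ?(ltW c2)//; lra.
have h2 : E * mean (mulT T T) <= E * (2 * m%:R)^-1 by exact: ler_wpM2l.
have h3 : E * (2 * m%:R)^-1 < P * c / 2.
  by rewrite ltr_pdivrMr ?mulr_gt0//; lra.
have h4 : P * c <= P * (k * mean (target sigma T g) - c).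
  rewrite ler_pM2l// lerBrDr -mulr2n.
  have := ler_wpM2l (ltW k0) Y4; rewrite /c; lra.
by rewrite mulrDr mulrA -/E; lra.
Qed.
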